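(* Let $\Lambda\ge\lambda>0$ and set $\omega=\Lambda/\lambda\ge 1$. Let $\frac{1}{\sqrt\omega}\le\gamma\le\sqrt\omega$ and $a\in\mathbb{R}$ with $|a|<\pi$. Let $\Omega^\omega_\gamma$ and $u^\omega_\gamma$ be as defined in the context, let $C_a$ be the linear map of $\mathbb{R}^2$ given by the matrix $C_a=\begin{pmatrix}\sqrt{1-(a/\pi)^2} & 0\\ a/\pi & 1\end{pmatrix}$, and set $\Omega^\omega_{\gamma,a}=C_a(\Omega^\omega_\gamma)$ and $u^\omega_{\gamma,a}(x,y)=u^\omega_\gamma(C_a^{-1}(x,y))$ for $(x,y)\in\Omega^\omega_{\gamma,a}$. Then $$-\mathcal{M}^+_{\lambda,\Lambda}(D^2u^\omega_{\gamma,a})\ge\frac{\lambda\pi^2}{\pi^2-a^2}\,u^\omega_{\gamma,a}\ \text{in }\Omega^\omega_{\gamma,a},\qquad u^\omega_{\gamma,a}>0\ \text{in }\Omega^\omega_{\gamma,a},\qquad u^\omega_{\gamma,a}=0\ \text{on }\partial\Omega^\omega_{\gamma,a}.$$ Consequently the positive principal eigenvalue of $\mathcal{M}^+_{\lambda,\Lambda}$ in $\Omega^\omega_{\gamma,a}$ satisfies $\mu(\Omega^\omega_{\gamma,a})\ge\frac{\lambda\pi^2}{\pi^2-a^2}$, with equality if and only if either $\omega=1$ or $a=0$.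
   Context: For $0<\lambda\le\Lambda$, the Pucci supremum operator is defined on $2\times 2$ real symmetric matrices $X$ by $\mathcal{M}^+_{\lambda,\Lambda}(X)=\lambda\sum_{e_i<0}e_i+\Lambda\sum_{e_i>0}e_i$, where $e_i$ are the eigenvalues of $X$. For a bounded Lipschitz domain $\Omega$, the positive principal eigenvalue is $\mu(\Omega)=\sup\{\mu\in\mathbb{R}:\exists\,\phi>0\text{ in }\Omega,\ \mathcal{M}^+_{\lambda,\Lambda}(D^2\phi)+\mu\phi\le 0\text{ in }\Omega\}$ (in the viscosity sense). For $\omega\ge1$ and $\frac{1}{\sqrt\omega}\le\gamma\le\sqrt\omega$, $\phi^\omega_\gamma$ is the even function on $|x|\le \frac{\pi}{2}+\sqrt\omega\arcsin\left(\frac{1}{\gamma\sqrt\omega}\right)$ given by $\phi^\omega_\gamma(x)=\frac{\pi}{2}+\sqrt\omega\arcsin\left(\frac{\gamma}{\sqrt\omega}\cos x\right)$ for $|x|\le\frac{\pi}{2}$ and $\phi^\omega_\gamma(x)=\arccos\left(\gamma\sqrt\omega\sin\left(\frac{|x|-\pi/2}{\sqrt\omega}\right)\right)$ for $\frac{\pi}{2}<|x|\le\frac{\pi}{2}+\sqrt\omega\arcsin\left(\frac{1}{\gamma\sqrt\omega}\right)$; $\Omega^\omega_\gamma=\{(x,y):|y|<\phi^\omega_\gamma(x)\}$; and $u^\omega_\gamma$ on $\overline{\Omega^\omega_\gamma}$ is given by $u^\omega_\gamma(x,y)=\gamma\cos x+\cos y$ if $|x|,|y|\le\frac{\pi}{2}$;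 $u^\omega_\gamma(x,y)=\gamma\sqrt\omega\cos\left(\frac{|x|-\pi/2}{\sqrt\omega}+\frac{\pi}{2}\right)+\cos y$ if $|x|\ge\frac{\pi}{2}$; $u^\omega_\gamma(x,y)=\gamma\cos x+\sqrt\omega\cos\left(\frac{|y|-\pi/2}{\sqrt\omega}+\frac{\pi}{2}\right)$ if $|y|\ge\frac{\pi}{2}$. *)

(* Defs.v *)
From Stdlib Require Import Reals Lra.
From Coquelicot Require Import Coquelicot.
Open Scope R_scope.

Definition dist2 (p q : R * R) : R := (fst p - fst q) ^ 2 + (snd p - snd q) ^ 2.

(* Pucci supremum operator on the symmetric matrix [[p, q], [q, r]]:
   lambda * (sum of negative eigenvalues) + Lambda * (sum of positive eigenvalues),
   the eigenvalues being m +- d as below. *)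
Definition pucci_plus (lam Lam p q r : R) : R :=
  let m := (p + r) / 2 in
  let d := sqrt (((p - r) / 2) ^ 2 + q ^ 2) in
  let e1 := m + d in
  let e2 := m - d in
  lam * (Rmin e1 0 + Rmin e2 0) + Lam * (Rmax e1 0 + Rmax e2 0).

Definition pdx (f : R * R -> R) (p : R * R) : R := Derive (fun t => f (t, snd p)) (fst p).
Definition pdy (f : R * R -> R) (p : R * R) : R := Derive (fun t => f (fst p, t)) (snd p).

Definition C2 (f : R * R -> R) : Prop :=
  forall p : R * R,
    ex_derive (fun t => f (t, snd p)) (fst p) /\ ex_derive (fun t => f (fst p, t)) (snd p) /\
    ex_derive (fun t => pdx f (t, snd p)) (fst p) /\ ex_derive (fun t => pdx f (fst p, t)) (snd p) /\
    ex_derive (fun t => pdy f (t, snd p)) (fst p) /\ ex_derive (fun t => pdy f (fst p, t)) (snd p) /\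
    continuous f p /\ continuous (pdx f) p /\ continuous (pdy f) p /\
    continuous (pdx (pdx f)) p /\ continuous (pdy (pdx f)) p /\
    continuous (pdx (pdy f)) p /\ continuous (pdy (pdy f)) p.

Definition pucciD2 (lam Lam : R) (psi : R * R -> R) (p : R * R) : R :=
  pucci_plus lam Lam (pdx (pdx psi) p) (pdy (pdx psi) p) (pdy (pdy psi) p).

Definition touches_below (Om : R * R -> Prop) (u psi : R * R -> R) (p0 : R * R) : Prop :=
  exists delta, 0 < delta /\
    forall p, Om p -> dist2 p p0 < delta ^ 2 -> u p - psi p >= u p0 - psi p0.

Definition visc_super (lam Lam mu : R) (Om : R * R -> Prop) (u : R * R -> R) : Prop :=
  forall (p0 : R * R) (psi : R * R -> R),
    Om p0 -> C2 psi -> touches_below Om u psi p0 ->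
    pucciD2 lam Lam psi p0 + mu * u p0 <= 0.

Definition cont_on (Om : R * R -> Prop) (f : R * R -> R) : Prop :=
  forall p, Om p -> forall eps, 0 < eps -> exists delta, 0 < delta /\
    forall q, Om q -> dist2 q p < delta ^ 2 -> Rabs (f q - f p) < eps.

Definition eig_set (lam Lam : R) (Om : R * R -> Prop) (mu : R) : Prop :=
  exists phi : R * R -> R,
    cont_on Om phi /\ (forall p, Om p -> 0 < phi p) /\ visc_super lam Lam mu Om phi.

Definition principal_eig (lam Lam : R) (Om : R * R -> Prop) : Rbar :=
  Lub_Rbar (eig_set lam Lam Om).

Definition boundary (Om : R * R -> Prop) (p : R * R) : Prop :=
  (forall e, 0 < e -> exists q, Om q /\ dist2 q p < e ^ 2) /\
  (forall e, 0 < e -> exists q, ~ Om q /\ dist2 q p < e ^ 2).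

Definition Xmax (om g : R) : R := PI / 2 + sqrt om * asin (1 / (g * sqrt om)).

Definition phi_og (om g x : R) : R :=
  if Rle_dec (Rabs x) (PI / 2) then PI / 2 + sqrt om * asin (g / sqrt om * cos x)
  else acos (g * sqrt om * sin ((Rabs x - PI / 2) / sqrt om)).

Definition Omega_og (om g : R) (p : R * R) : Prop :=
  Rabs (fst p) <= Xmax om g /\ Rabs (snd p) < phi_og om g (fst p).

Definition u_og (om g : R) (p : R * R) : R :=
  let x := fst p in let y := snd p in
  if Rle_dec (Rabs x) (PI / 2) then
    (if Rle_dec (Rabs y) (PI / 2) then g * cos x + cos y
     else g * cos x + sqrt om * cos ((Rabs y - PI / 2) / sqrt om + PI / 2))
  else g * sqrt om * cos ((Rabs x - PI / 2) / sqrt om + PI / 2) + cos y.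

Definition Ca (a : R) (p : R * R) : R * R :=
  (sqrt (1 - (a / PI) ^ 2) * fst p, a / PI * fst p + snd p).
Definition Ca_inv (a : R) (p : R * R) : R * R :=
  (fst p / sqrt (1 - (a / PI) ^ 2), snd p - a / PI * (fst p / sqrt (1 - (a / PI) ^ 2))).

Definition Omega_oga (om g a : R) (p : R * R) : Prop :=
  exists q, Omega_og om g q /\ p = Ca a q.
Definition u_oga (om g a : R) (p : R * R) : R := u_og om g (Ca_inv a p).

(* Main.v *)
(** Idea. Write [q = Ca_inv p]. On the domain, [u] is a sum [f x + h y] of two C2 profiles with
    [f'' = - f] where [f >= 0] and [f'' = - f / om] where [f <= 0], so each one-dimensional Hessian
    has Pucci value [- lam f], resp. [- lam h]; the shear [Ca] only turns the two orthogonal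
    directions into non-orthogonal ones, and subadditivity of the Pucci operator gives the
    supersolution property.

    When [om = 1] or [a = 0] there is equality. A supersolution [phi] for a larger constant is then
    contradicted by comparing it with the eigenfunction of a slightly smaller homothetic domain,
    whose closure is compactly contained in the domain.

    When [om > 1] and [a <> 0] the inequality is strict exactly where [f'' h'' < 0]. This is
    propagated to the whole domain by the Hopf-type perturbation
    [u - eps (exp (al w) - 1)], [w = exp (2 y / g) u]: the exponential weight moves the only
    interior critical point of [w] into the region where [f'' h'' < 0]. *)
Require Import Defs.
From Stdlib Require Import Reals Lra Psatz Classical ClassicalEpsilon FunctionalExtensionality.
From Coquelicot Require Import Coquelicot.
Open Scope R_scope.

(** * The Pucci operator *)

(** Test functions must be C2 on the whole plane, whereas [u_oga] has the right values on the closed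
    domain only. The profiles are therefore continued to the line; value and second derivative
    vanish at the junctions, so their sum [V] is C2. The domain is the part of [V > 0] inside a
    parallelogram, outside of which the oscillating continuation becomes positive again. The two
    bounds on [g] say exactly that [V <= 0] on the edges of that parallelogram.

    Subadditivity alone would give no quantity. The top eigenvalue of the sheared Hessian is
    computed instead: it drops by a multiple of [al ^ 2 * |f'' h''|] when the signs differ. This
    gain is zero at the centre, where [u] has its maximum and its gradient vanishes too, so a
    perturbation by a function of [u] alone gains nothing there; hence the weight, with exponent
    [2 / g] chosen to dominate the slope of the other profile.

    In the equality case [phi] is merely continuous and positive in the open domain, with no
    information at the boundary. On the smaller domain the contact is interior, and the touching
    function, being smooth, is itself an admissible test function. *)

Lemma Rmin_eq_sub_Rmax (x y : R) : Rmin x y = x + y - Rmax x y.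
Proof. unfold Rmin, Rmax; destruct (Rle_dec x y); ring. Qed.

Definition top_eig (p q r : R) : R := (p + r) / 2 + sqrt (((p - r) / 2) ^ 2 + q ^ 2).

(** The positive parts of the two eigenvalues add up to the largest of 0, the trace and the top
    eigenvalue. Each of these is convex and positively homogeneous in the matrix, so subadditivity
    and scaling can be read off. *)
Lemma pucci_plusE (lam Lam p q r : R) :
  pucci_plus lam Lam p q r =
  lam * (p + r) + (Lam - lam) * Rmax 0 (Rmax (p + r) (top_eig p q r)).
Proof.
unfold pucci_plus, top_eig.
set (d := sqrt _).
assert (hd : 0 <= d) by apply sqrt_pos.
rewrite !Rmin_eq_sub_Rmax.
replace (Rmax 0 (Rmax (p + r) ((p + r) / 2 + d)))
  with (Rmax ((p + r) / 2 + d) 0 + Rmax ((p + r) / 2 - d) 0).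
- field.
- unfold Rmax; repeat destruct Rle_dec; lra.
Qed.

Lemma sqrt_sum_sq_triangle (x y x' y' : R) :
  sqrt ((x + x') ^ 2 + (y + y') ^ 2) <= sqrt (x ^ 2 + y ^ 2) + sqrt (x' ^ 2 + y' ^ 2).
Proof.
assert (h1 := sqrt_pos (x ^ 2 + y ^ 2)). assert (h2 := sqrt_pos (x' ^ 2 + y' ^ 2)).
assert (e1 : sqrt (x ^ 2 + y ^ 2) ^ 2 = x ^ 2 + y ^ 2)
  by (rewrite pow2_sqrt; [ring | nra]).
assert (e2 : sqrt (x' ^ 2 + y' ^ 2) ^ 2 = x' ^ 2 + y' ^ 2)
  by (rewrite pow2_sqrt; [ring | nra]).
set (n := sqrt (x ^ 2 + y ^ 2)) in *. set (n' := sqrt (x' ^ 2 + y' ^ 2)) in *.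
rewrite <- (sqrt_pow2 (n + n')) by lra.
apply sqrt_le_1_alt.
assert (x * x' + y * y' <= n * n').
{ apply Rsqr_incr_0_var; [|nra]. unfold Rsqr.
  assert (h := pow2_ge_0 (x * y' - x' * y)).
  replace (n * n' * (n * n')) with (n ^ 2 * n' ^ 2) by ring. rewrite e1, e2. nra. }
nra.
Qed.

Lemma top_eig_subadd (p q r p' q' r' : R) :
  top_eig (p + p') (q + q') (r + r') <= top_eig p q r + top_eig p' q' r'.
Proof.
unfold top_eig.
assert (h := sqrt_sum_sq_triangle ((p - r) / 2) q ((p' - r') / 2) q').
replace ((p + p' - (r + r')) / 2) with ((p - r) / 2 + (p' - r') / 2) by field.
lra.
Qed.

Lemma Rmax0_subadd (x y x' y' z : R) :
  z <= y + y' ->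
  Rmax 0 (Rmax (x + x') z) <= Rmax 0 (Rmax x y) + Rmax 0 (Rmax x' y').
Proof. intros h; unfold Rmax; repeat destruct Rle_dec; lra. Qed.

Lemma pucci_plus_subadd (lam Lam p q r p' q' r' : R) : lam <= Lam ->
  pucci_plus lam Lam (p + p') (q + q') (r + r') <=
  pucci_plus lam Lam p q r + pucci_plus lam Lam p' q' r'.
Proof.
intros hl; rewrite !pucci_plusE.
assert (h := Rmax0_subadd (p + r) _ (p' + r') _ _ (top_eig_subadd p q r p' q' r')).
replace (p + p' + (r + r')) with (p + r + (p' + r')) by ring.
nra.
Qed.

Lemma pucci_plus_scal (lam Lam k p q r : R) : 0 <= k ->
  pucci_plus lam Lam (k * p) (k * q) (k * r) = k * pucci_plus lam Lam p q r.
Proof.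
intros hk; rewrite !pucci_plusE.
replace (top_eig (k * p) (k * q) (k * r)) with (k * top_eig p q r).
- rewrite <- Rmult_plus_distr_l, RmaxRmult by assumption.
  rewrite <- (Rmult_0_r k) at 1.
  rewrite RmaxRmult by assumption. ring.
- unfold top_eig.
  replace (((k * p - k * r) / 2) ^ 2 + (k * q) ^ 2)
    with (k ^ 2 * (((p - r) / 2) ^ 2 + q ^ 2)) by field.
  rewrite sqrt_mult_alt by apply pow2_ge_0. rewrite sqrt_pow2 by assumption. field.
Qed.

Lemma top_eig_npos (p q r : R) : p <= 0 -> r <= 0 -> q ^ 2 <= p * r -> top_eig p q r <= 0.
Proof.
intros hp hr hq; unfold top_eig.
enough (sqrt (((p - r) / 2) ^ 2 + q ^ 2) <= - (p + r) / 2) by lra.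
rewrite <- (sqrt_pow2 (- (p + r) / 2)) by lra.
apply sqrt_le_1_alt; nra.
Qed.

(** The hypotheses encode negative semidefiniteness by the diagonal and the determinant, the form in
    which [nsd_entries] delivers it. *)
Lemma pucci_plus_nsd (lam Lam p q r : R) :
  p <= 0 -> r <= 0 -> q ^ 2 <= p * r -> pucci_plus lam Lam p q r = lam * (p + r).
Proof.
intros hp hr hq; rewrite pucci_plusE.
rewrite Rmax_left; [ring |].
apply Rmax_lub; [lra | now apply top_eig_npos].
Qed.

(** Ellipticity follows from subadditivity applied to [X = X' + (X - X')]: on the negative
    semidefinite difference the operator is [lam] times the trace, hence nonpositive. *)
Lemma pucci_plus_mono (lam Lam p q r p' q' r' : R) : 0 < lam -> lam <= Lam ->
  p - p' <= 0 -> r - r' <= 0 -> (q - q') ^ 2 <= (p - p') * (r - r') ->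
  pucci_plus lam Lam p q r <= pucci_plus lam Lam p' q' r'.
Proof.
intros h0 hl hp hr hq.
assert (h := pucci_plus_subadd lam Lam p' q' r' (p - p') (q - q') (r - r') hl).
rewrite (pucci_plus_nsd _ _ (p - p')) in h by assumption.
replace (p' + (p - p')) with p in h by ring.
replace (q' + (q - q')) with q in h by ring.
replace (r' + (r - r')) with r in h by ring.
nra.
Qed.

Lemma pucci_plus_le_abs (lam Lam p q r : R) : 0 < lam -> lam <= Lam ->
  pucci_plus lam Lam p q r <= 2 * Lam * (Rabs p + Rabs q + Rabs r).
Proof.
intros h0 hl; rewrite pucci_plusE.
assert (ht : top_eig p q r <= Rabs p + Rabs q + Rabs r).
{ unfold top_eig.
  assert (h := sqrt_sum_sq_triangle ((p - r) / 2) 0 0 q).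
  rewrite Rplus_0_l, Rplus_0_r in h.
  replace (((p - r) / 2) ^ 2 + 0 ^ 2) with (((p - r) / 2)²) in h by (unfold Rsqr; ring).
  replace (0 ^ 2 + q ^ 2) with (q²) in h by (unfold Rsqr; ring).
  rewrite !sqrt_Rsqr_abs in h.
  assert (Rabs ((p - r) / 2) <= (Rabs p + Rabs r) / 2)
    by (unfold Rabs; repeat destruct Rcase_abs; lra).
  assert (hp := Rle_abs p). assert (hr := Rle_abs r). lra. }
assert (hp := Rle_abs p). assert (hr := Rle_abs r).
assert (hp' := Rabs_pos p). assert (hq' := Rabs_pos q). assert (hr' := Rabs_pos r).
assert (hm : Rmax 0 (Rmax (p + r) (top_eig p q r)) <= Rabs p + Rabs q + Rabs r)
  by (repeat apply Rmax_lub; lra).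
nra.
Qed.

(** * Differentiation in one variable and the second derivative test *)

Lemma is_derive_plusR (f g : R -> R) (x a b : R) :
  is_derive f x a -> is_derive g x b -> is_derive (fun t => f t + g t) x (a + b).
Proof. exact (is_derive_plus f g x a b). Qed.

Lemma is_derive_multR (f g : R -> R) (x a b : R) :
  is_derive f x a -> is_derive g x b -> is_derive (fun t => f t * g t) x (a * g x + f x * b).
Proof. intros ha hb; exact (is_derive_mult f g x a b ha hb Rmult_comm). Qed.

Lemma is_derive_compR (f g : R -> R) (x a b : R) :
  is_derive f (g x) a -> is_derive g x b -> is_derive (fun t => f (g t)) x (a * b).
Proof.
intros ha hb; rewrite Rmult_comm; exact (is_derive_comp f g x a b ha hb).
Qed.

Lemma is_derive_eq (f : R -> R) (x a b : R) : is_derive f x a -> a = b -> is_derive f x b.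
Proof. now intros h <-. Qed.

Lemma second_derivative_test (f f1 : R -> R) (l : R) :
  (forall t, is_derive f t (f1 t)) -> is_derive f1 0 l ->
  (exists d, 0 < d /\ forall t, Rabs t < d -> f t <= f 0) -> l <= 0.
Proof.
intros h1 h2 [d [hd hmax]].
destruct (Rle_or_lt l 0) as [|hl]; [assumption | exfalso].
apply is_derive_Reals in h2.
destruct (h2 (l / 2) ltac:(lra)) as [[d' hd'] h2']; simpl in h2'.
set (t := Rmin d d' / 2).
assert (ht : 0 < t) by (unfold t; apply Rmin_case; lra).
assert (htd : t < d /\ t < d')
  by (unfold t; assert (a1 := Rmin_l d d'); assert (a2 := Rmin_r d d');
      assert (0 < Rmin d d') by (apply Rmin_case; lra); lra).
(* The even part of [f] around 0 also has a maximum at 0, and it has zero derivative there. *)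
destruct (MVT_cor2 (fun t => f t + f (- t)) (fun t => f1 t - f1 (- t)) 0 t ht)
  as [c [e [hc0 hct]]].
{ intros c _; apply is_derive_Reals.
  eapply is_derive_eq.
  - apply is_derive_plusR; [apply h1 |].
    apply (is_derive_compR f Ropp c (f1 (- c)) (- 1)); [apply h1 |].
    auto_derive; [exact I | ring].
  - ring. }
(* Both difference quotients of [f1] at 0 exceed [l / 2 > 0], so [f1 c - f1 (- c) > 0] and the even
   part has increased between 0 and [t]. *)
assert (a1 := h2' c ltac:(lra) ltac:(rewrite Rabs_pos_eq; lra)).
assert (a2 := h2' (- c) ltac:(lra) ltac:(rewrite Rabs_Ropp, Rabs_pos_eq; lra)).
rewrite Rplus_0_l in a1, a2.
apply Rabs_def2 in a1; apply Rabs_def2 in a2.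
assert (b1 : f1 c - f1 0 > c * (l / 2)).
{ replace (f1 c - f1 0) with (c * ((f1 c - f1 0) / c)) by (field; lra). nra. }
assert (b2 : f1 0 - f1 (- c) > c * (l / 2)).
{ replace (f1 0 - f1 (- c)) with (c * ((f1 (- c) - f1 0) / - c)) by (field; lra). nra. }
assert (m1 := hmax t ltac:(rewrite Rabs_pos_eq; lra)).
assert (m2 := hmax (- t) ltac:(rewrite Rabs_Ropp, Rabs_pos_eq; lra)).
rewrite Ropp_0 in e.
assert (0 < (f1 c - f1 (- c)) * (t - 0)) by (apply Rmult_lt_0_compat; nra).
lra.
Qed.

(** * Second order jets and viscosity supersolutions *)

(** A C2 function bundled with explicit partial derivatives, so that computations avoid [Derive].
    The single [fxy] serves for both orders of mixed differentiation. *)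
Record jet (f fx fy fxx fxy fyy : R * R -> R) : Prop := {
  jet_x : forall x y, is_derive (fun t => f (t, y)) x (fx (x, y));
  jet_y : forall x y, is_derive (fun t => f (x, t)) y (fy (x, y));
  jet_xx : forall x y, is_derive (fun t => fx (t, y)) x (fxx (x, y));
  jet_xy : forall x y, is_derive (fun t => fx (x, t)) y (fxy (x, y));
  jet_yx : forall x y, is_derive (fun t => fy (t, y)) x (fxy (x, y));
  jet_yy : forall x y, is_derive (fun t => fy (x, t)) y (fyy (x, y));
  jet_cont : forall p, continuous f p;
  jet_cont_x : forall p, continuous fx p;
  jet_cont_y : forall p, continuous fy p;
  jet_cont_xx : forall p, continuous fxx p;
  jet_cont_xy : forall p, continuous fxy p;
  jet_cont_yy : forall p, continuous fyy p }.

Section Jet.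
Variables (f fx fy fxx fxy fyy : R * R -> R).
Hypothesis J : jet f fx fy fxx fxy fyy.

Lemma jet_pdx : pdx f = fx.
Proof. apply functional_extensionality; intros [x y]; apply is_derive_unique, (jet_x _ _ _ _ _ _ J). Qed.

Lemma jet_pdy : pdy f = fy.
Proof. apply functional_extensionality; intros [x y]; apply is_derive_unique, (jet_y _ _ _ _ _ _ J). Qed.

Lemma jet_pdxx : pdx (pdx f) = fxx.
Proof.
rewrite jet_pdx; apply functional_extensionality; intros [x y].
apply is_derive_unique, (jet_xx _ _ _ _ _ _ J).
Qed.

Lemma jet_pdxy : pdy (pdx f) = fxy.
Proof.
rewrite jet_pdx; apply functional_extensionality; intros [x y].
apply is_derive_unique, (jet_xy _ _ _ _ _ _ J).
Qed.

Lemma jet_pdyx : pdx (pdy f) = fxy.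
Proof.
rewrite jet_pdy; apply functional_extensionality; intros [x y].
apply is_derive_unique, (jet_yx _ _ _ _ _ _ J).
Qed.

Lemma jet_pdyy : pdy (pdy f) = fyy.
Proof.
rewrite jet_pdy; apply functional_extensionality; intros [x y].
apply is_derive_unique, (jet_yy _ _ _ _ _ _ J).
Qed.

Lemma jet_C2 : C2 f.
Proof.
intros [x y]; rewrite jet_pdxx, jet_pdxy, jet_pdyx, jet_pdyy, jet_pdx, jet_pdy.
destruct J; simpl; repeat split; auto; eexists; auto.
Qed.

Lemma jet_pucciD2 (lam Lam : R) (p : R * R) :
  pucciD2 lam Lam f p = pucci_plus lam Lam (fxx p) (fxy p) (fyy p).
Proof. unfold pucciD2; now rewrite jet_pdxx, jet_pdxy, jet_pdyy. Qed.
End Jet.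

Lemma continuous_surj_pair (f : R * R -> R) (p : R * R) :
  continuous f p -> continuous (fun q : R * R => f (fst q, snd q)) p.
Proof. apply continuous_ext; now intros []. Qed.

(** [C2] does not postulate that the mixed derivatives agree; Schwarz's theorem supplies it from
    their continuity. Arbitrary test functions thereby enter the jet calculus. *)
Lemma C2_jet (f : R * R -> R) : C2 f ->
  jet f (pdx f) (pdy f) (pdx (pdx f)) (pdy (pdx f)) (pdy (pdy f)).
Proof.
intros H.
assert (S : forall x y, pdy (pdx f) (x, y) = pdx (pdy f) (x, y)).
{ intros x y; symmetry; unfold pdx, pdy; simpl.
  apply (Schwarz (fun u v => f (u, v)) x y).
  - exists (mkposreal 1 Rlt_0_1); intros u v _ _.
    destruct (H (u, v)) as (h1 & h2 & _ & h4 & h5 & _).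
    repeat split; assumption.
  - apply continuity_2d_pt_filterlim; simpl.
    destruct (H (x, y)) as (_ & _ & _ & _ & _ & _ & _ & _ & _ & _ & _ & h & _).
    exact (continuous_surj_pair _ _ h).
  - apply continuity_2d_pt_filterlim; simpl.
    destruct (H (x, y)) as (_ & _ & _ & _ & _ & _ & _ & _ & _ & _ & h & _).
    exact (continuous_surj_pair _ _ h). }
split; try (intros x y; destruct (H (x, y)) as (h1 & h2 & h3 & h4 & h5 & h6 & _));
  try (intros p; now destruct (H p) as (_ & _ & _ & _ & _ & _ & ? & ? & ? & ? & ? & ? & ?)).
- exact (Derive_correct _ _ h1).
- exact (Derive_correct _ _ h2).
- exact (Derive_correct _ _ h3).
- exact (Derive_correct _ _ h4).
- rewrite S; exact (Derive_correct _ _ h5).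
- exact (Derive_correct _ _ h6).
Qed.

Lemma continuous_plusR (f g : R * R -> R) (p : R * R) :
  continuous f p -> continuous g p -> continuous (fun q => f q + g q) p.
Proof. exact (continuous_plus f g p). Qed.

Lemma continuous_multR (f g : R * R -> R) (p : R * R) :
  continuous f p -> continuous g p -> continuous (fun q => f q * g q) p.
Proof. exact (continuous_mult f g p). Qed.

Lemma continuous_compR (f : R * R -> R) (g : R -> R) (p : R * R) :
  continuous f p -> continuous g (f p) -> continuous (fun q => g (f q)) p.
Proof. exact (continuous_comp f g p). Qed.

Ltac prove_continuous :=
  cbv beta;
  lazymatch goal with
  | |- continuous (fun _ => ?k) _ => apply continuous_const
  | |- continuous (fun q => @?a q + @?b q) _ => apply (continuous_plusR a b); prove_continuous
  | |- continuous (fun q => @?a q * @?b q) _ => apply (continuous_multR a b); prove_continuous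
  | |- _ => auto
  end.

Ltac prove_derive :=
  cbv beta;
  lazymatch goal with
  | |- is_derive (fun _ => ?k) _ _ => exact (is_derive_const k _)
  | |- is_derive (fun q => @?a q + @?b q) _ _ => apply (is_derive_plusR a b); prove_derive
  | |- is_derive (fun q => @?a q * @?b q) _ _ => apply (is_derive_multR a b); prove_derive
  | |- _ => auto
  end.

Lemma jet_const (k : R) :
  jet (fun _ => k) (fun _ => 0) (fun _ => 0) (fun _ => 0) (fun _ => 0) (fun _ => 0).
Proof. split; intros; try apply continuous_const; exact (is_derive_const _ _). Qed.

Lemma jet_linear (a b : R) :
  jet (fun p => a * fst p + b * snd p)
    (fun _ => a) (fun _ => b) (fun _ => 0) (fun _ => 0) (fun _ => 0).
Proof.
split; intros; try apply continuous_const; try exact (is_derive_const _ _); simpl.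
- auto_derive; [exact I | ring].
- auto_derive; [exact I | ring].
- apply continuous_plusR; apply continuous_multR; try apply continuous_const;
    destruct p; [apply continuous_fst | apply continuous_snd].
Qed.

Section JetOps.
Variables (f fx fy fxx fxy fyy g gx gy gxx gxy gyy : R * R -> R).
Hypotheses (Jf : jet f fx fy fxx fxy fyy) (Jg : jet g gx gy gxx gxy gyy).

Lemma jet_plus :
  jet (fun p => f p + g p) (fun p => fx p + gx p) (fun p => fy p + gy p)
    (fun p => fxx p + gxx p) (fun p => fxy p + gxy p) (fun p => fyy p + gyy p).
Proof.
destruct Jf, Jg; split; intros; try prove_continuous; prove_derive.
Qed.

Lemma jet_mult :
  jet (fun p => f p * g p)
    (fun p => fx p * g p + f p * gx p) (fun p => fy p * g p + f p * gy p)
    (fun p => fxx p * g p + 2 * (fx p * gx p) + f p * gxx p)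
    (fun p => fxy p * g p + fx p * gy p + fy p * gx p + f p * gxy p)
    (fun p => fyy p * g p + 2 * (fy p * gy p) + f p * gyy p).
Proof.
destruct Jf, Jg; split; intros; try prove_continuous;
  (eapply is_derive_eq; [prove_derive | simpl; ring]).
Qed.

Lemma jet_scal (k : R) :
  jet (fun p => k * f p) (fun p => k * fx p) (fun p => k * fy p)
    (fun p => k * fxx p) (fun p => k * fxy p) (fun p => k * fyy p).
Proof.
destruct Jf; split; intros; try prove_continuous; apply is_derive_scal; auto.
Qed.

Lemma jet_comp (G G1 G2 : R -> R) :
  (forall t, is_derive G t (G1 t)) -> (forall t, is_derive G1 t (G2 t)) ->
  (forall t, continuous G2 t) ->
  jet (fun p => G (f p)) (fun p => G1 (f p) * fx p) (fun p => G1 (f p) * fy p)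
    (fun p => G2 (f p) * (fx p * fx p) + G1 (f p) * fxx p)
    (fun p => G2 (f p) * (fx p * fy p) + G1 (f p) * fxy p)
    (fun p => G2 (f p) * (fy p * fy p) + G1 (f p) * fyy p).
Proof.
intros h1 h2 h3.
assert (c0 : forall t, continuous G t)
  by (intros t; apply (ex_derive_continuous G); eexists; apply h1).
assert (c1 : forall t, continuous G1 t)
  by (intros t; apply (ex_derive_continuous G1); eexists; apply h2).
destruct Jf.
assert (d0 := fun p => continuous_compR f G p (jet_cont0 p) (c0 _)).
assert (d1 := fun p => continuous_compR f G1 p (jet_cont0 p) (c1 _)).
assert (d2 := fun p => continuous_compR f G2 p (jet_cont0 p) (h3 _)).
assert (dx := fun x y => is_derive_compR G1 (fun t => f (t, y)) x _ _ (h2 _) (jet_x0 x y)).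
assert (dy := fun x y => is_derive_compR G1 (fun t => f (x, t)) y _ _ (h2 _) (jet_y0 x y)).
split; intros; try prove_continuous.
- exact (is_derive_compR G (fun t => f (t, y)) x _ _ (h1 _) (jet_x0 x y)).
- exact (is_derive_compR G (fun t => f (x, t)) y _ _ (h1 _) (jet_y0 x y)).
- eapply is_derive_eq; [prove_derive | simpl; ring].
- eapply is_derive_eq; [prove_derive | simpl; ring].
- eapply is_derive_eq; [prove_derive | simpl; ring].
- eapply is_derive_eq; [prove_derive | simpl; ring].
Qed.
End JetOps.

(** Partial derivatives alone give no chain rule along oblique lines; the total differential comes
    from the continuity of [fx]. *)
Lemma is_derive_line (f fx fy : R * R -> R) (x y v w t : R) :
  (forall x y, is_derive (fun t => f (t, y)) x (fx (x, y))) ->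
  (forall x y, is_derive (fun t => f (x, t)) y (fy (x, y))) ->
  (forall p, continuous fx p) ->
  is_derive (fun t => f (x + t * v, y + t * w)) t
    (v * fx (x + t * v, y + t * w) + w * fy (x + t * v, y + t * w)).
Proof.
intros hx hy hc.
apply is_derive_Reals.
rewrite (Rmult_comm v), (Rmult_comm w).
apply (derivable_pt_lim_comp_2d (fun a b => f (a, b))).
- apply filterdiff_differentiable_pt_lim.
  eapply filterdiff_ext_lin.
  + apply (is_derive_filterdiff (fun a b => f (a, b)) _ _ (fun a b => fx (a, b))).
    * apply filter_forall; intros [a b]; apply hx.
    * apply hy.
    * apply continuous_surj_pair, hc.
  + reflexivity.
- apply is_derive_Reals; auto_derive; [exact I | ring].
- apply is_derive_Reals; auto_derive; [exact I | ring].
Qed.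

Lemma nsd_entries (p q r : R) :
  (forall v w, v ^ 2 * p + 2 * (v * w) * q + w ^ 2 * r <= 0) ->
  p <= 0 /\ r <= 0 /\ q ^ 2 <= p * r.
Proof.
intros h.
assert (hp := h 1 0). assert (hr := h 0 1).
assert (r <= 0) by lra.
split; [lra | split; [assumption |]].
destruct (Rle_lt_or_eq_dec r 0) as [hr' | ->]; [assumption | |].
(* At [(r, - q)] the form equals [r * (p * r - q ^ 2)], and [r < 0]. *)
- assert (h1 := h r (- q)).
  apply Rnot_lt_le; intros h2.
  assert (0 < - r * (q ^ 2 - p * r)) by (apply Rmult_lt_0_compat; lra). nra.
- destruct (Req_dec q 0) as [-> | hq]; [lra |].
  (* With [r = 0] the form is affine in [w] at [v = 1]; this [w] gives it the value 1. *)
  assert (h1 := h 1 ((1 - p) / (2 * q))).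
  replace (1 ^ 2 * p + 2 * (1 * ((1 - p) / (2 * q))) * q + ((1 - p) / (2 * q)) ^ 2 * 0)
    with 1 in h1 by (field; assumption). lra.
Qed.

Lemma jet_local_max (f fx fy fxx fxy fyy : R * R -> R) (p : R * R) :
  jet f fx fy fxx fxy fyy ->
  (exists d, 0 < d /\ forall q, dist2 q p < d ^ 2 -> f q <= f p) ->
  fxx p <= 0 /\ fyy p <= 0 /\ fxy p ^ 2 <= fxx p * fyy p.
Proof.
destruct p as [x y]; intros J [d [hd hmax]].
apply nsd_entries; intros v w.
apply (second_derivative_test (fun t => f (x + t * v, y + t * w))
  (fun t => v * fx (x + t * v, y + t * w) + w * fy (x + t * v, y + t * w))).
- intros t; destruct J; apply is_derive_line; auto.
- eapply is_derive_eq.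
  + apply is_derive_plusR; apply is_derive_scal.
    * apply (is_derive_line fx fxx fxy); destruct J; auto.
    * apply (is_derive_line fy fxy fyy); destruct J; auto.
  + rewrite !Rmult_0_l, !Rplus_0_r; ring.
- set (n := 1 + Rabs v + Rabs w).
  assert (hv := Rabs_pos v). assert (hw := Rabs_pos w).
  assert (hn : 0 < n) by (unfold n; lra).
  exists (d / n); split; [now apply Rdiv_lt_0_compat |].
  intros t ht; rewrite !Rmult_0_l, !Rplus_0_r; apply hmax.
  unfold dist2; simpl fst; simpl snd.
  assert (htn : Rabs t * n < d).
  { apply Rmult_lt_compat_r with (r := n) in ht; [|assumption].
    replace (d / n * n) with d in ht by (field; lra). assumption. }
  assert (hvw : v ^ 2 + w ^ 2 <= n ^ 2)
    by (rewrite <- (pow2_abs v), <- (pow2_abs w); unfold n; nra).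
  replace ((x + t * v - x) ^ 2 + (y + t * w - y) ^ 2) with (t ^ 2 * (v ^ 2 + w ^ 2)) by ring.
  assert (hta := Rabs_pos t). rewrite <- (pow2_abs t).
  assert (Rabs t ^ 2 * (v ^ 2 + w ^ 2) <= Rabs t ^ 2 * n ^ 2) by (apply Rmult_le_compat_l; nra).
  assert (0 <= Rabs t * n) by nra.
  nra.
Qed.

(** * Neighbourhoods in terms of [dist2], and classical supersolutions *)

Definition open2 (Om : R * R -> Prop) : Prop :=
  forall p, Om p -> exists d, 0 < d /\ forall q, dist2 q p < d ^ 2 -> Om q.

Lemma dist2_Rmin (d d' : R) (p q : R * R) : 0 < d -> 0 < d' ->
  dist2 p q < Rmin d d' ^ 2 -> dist2 p q < d ^ 2 /\ dist2 p q < d' ^ 2.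
Proof.
intros hd hd' h.
assert (a := Rmin_l d d'). assert (a' := Rmin_r d d').
assert (0 < Rmin d d') by (apply Rmin_case; lra).
split; nra.
Qed.

Lemma dist2_comp (p q : R * R) (d : R) : 0 < d -> dist2 q p < d ^ 2 ->
  Rabs (fst q - fst p) < d /\ Rabs (snd q - snd p) < d.
Proof.
unfold dist2; intros hd h.
assert (h1 := pow2_ge_0 (fst q - fst p)). assert (h2 := pow2_ge_0 (snd q - snd p)).
split; rewrite <- (Rabs_pos_eq d) by lra; apply Rsqr_lt_abs_0; unfold Rsqr; lra.
Qed.

Lemma comp_dist2 (p q : R * R) (d : R) :
  Rabs (fst q - fst p) < d / 2 -> Rabs (snd q - snd p) < d / 2 -> dist2 q p < d ^ 2.
Proof.
unfold dist2; intros h1 h2.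
rewrite <- (pow2_abs (fst q - fst p)), <- (pow2_abs (snd q - snd p)).
assert (a1 := Rabs_pos (fst q - fst p)). assert (a2 := Rabs_pos (snd q - snd p)). nra.
Qed.

Lemma continuous_dist2 (f : R * R -> R) (p : R * R) : continuous f p ->
  forall eps, 0 < eps -> exists d, 0 < d /\
    forall q, dist2 q p < d ^ 2 -> Rabs (f q - f p) < eps.
Proof.
intros h eps he.
destruct (h (fun z => Rabs (z - f p) < eps)) as [d hd].
- exists (mkposreal eps he); intros z hz; exact hz.
- exists d; split; [apply cond_pos |].
  intros q hq; apply hd; destruct (dist2_comp _ _ _ (cond_pos d) hq) as [h1 h2].
  split; assumption.
Qed.

Lemma continuous_lt_near (f : R * R -> R) (p : R * R) (b : R) : continuous f p -> f p < b ->
  exists d, 0 < d /\ forall q, dist2 q p < d ^ 2 -> f q < b.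
Proof.
intros hf hp; destruct (continuous_dist2 f p hf (b - f p)) as [d [hd h]]; [lra |].
exists d; split; [assumption |]; intros q hq.
assert (e := h q hq); apply Rabs_def2 in e; lra.
Qed.

Lemma continuous_RabsR (f : R * R -> R) (p : R * R) :
  continuous f p -> continuous (fun q => Rabs (f q)) p.
Proof. intros h; apply (continuous_compR f Rabs); [assumption | apply continuous_Rabs]. Qed.

Lemma continuous_oppR (f : R * R -> R) (p : R * R) :
  continuous f p -> continuous (fun q => - f q) p.
Proof. exact (continuous_opp f p). Qed.

(** At a contact point [psi - V] has a local maximum, so its Hessian is negative semidefinite and
    ellipticity carries the classical inequality of [V] over to [psi]. The role of [V] is that of a
    C2 extension of [u] to the plane. *)
Lemma smooth_visc_super (lam Lam mu : R) (Om : R * R -> Prop) (u V Vx Vy Vxx Vxy Vyy : R * R -> R) :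
  0 < lam -> lam <= Lam -> open2 Om -> jet V Vx Vy Vxx Vxy Vyy ->
  (forall p, Om p -> u p = V p) ->
  (forall p, Om p -> pucci_plus lam Lam (Vxx p) (Vxy p) (Vyy p) + mu * V p <= 0) ->
  visc_super lam Lam mu Om u.
Proof.
intros h0 hl hO J hu hV p psi hp Hpsi [d [hd ht]].
assert (Jp := C2_jet _ Hpsi).
destruct (hO p hp) as [d' [hd' hO']].
assert (JD := jet_plus _ _ _ _ _ _ _ _ _ _ _ _ Jp (jet_scal _ _ _ _ _ _ J (- 1))).
destruct (jet_local_max _ _ _ _ _ _ p JD) as (a1 & a2 & a3).
{ exists (Rmin d d'); split; [apply Rmin_case; assumption |].
  intros q hq; apply dist2_Rmin in hq; [destruct hq as [hq hq'] | assumption | assumption].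
  assert (h := ht q (hO' q hq') hq).
  rewrite !hu in h by auto. lra. }
rewrite (jet_pucciD2 _ _ _ _ _ _ Jp), hu by assumption.
eapply Rle_trans; [| apply (hV p hp)].
apply Rplus_le_compat_r, pucci_plus_mono; try assumption; try lra.
Qed.

Lemma smooth_cont_on (Om : R * R -> Prop) (u V : R * R -> R) :
  (forall p, Om p -> u p = V p) -> (forall p, continuous V p) -> cont_on Om u.
Proof.
intros hu hV p hp eps he.
destruct (continuous_dist2 V p (hV p) eps he) as [d [hd h]].
exists d; split; [assumption |]; intros q hq hqp.
rewrite !hu by assumption; auto.
Qed.

(** * Compactness of the square *)

(* The points outside [K] need a neighbourhood missing [K], so this says that [K] is closed in the
   square and that [f] is locally bounded below on [K] by positive constants. *)
Definition locally_bounded_below (M : R) (K : R * R -> Prop) (f : R * R -> R) : Prop :=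
  forall p, Rabs (fst p) <= M -> Rabs (snd p) <= M ->
  exists b, 0 < b /\ forall q, K q -> dist2 q p < b ^ 2 -> b <= f q.

(** In [locally_bounded_below] one number is both the radius and the lower bound, so a positive
    lower bound for the radii of the covering is one for [f]. *)
Lemma square_bounded_below (M : R) (K : R * R -> Prop) (f : R * R -> R) :
  (forall p, K p -> Rabs (fst p) <= M /\ Rabs (snd p) <= M) ->
  locally_bounded_below M K f ->
  exists b, 0 < b /\ forall q, K q -> b <= f q.
Proof.
intros hK hf.
assert (H : forall p : R * R, exists b : posreal,
  Rabs (fst p) <= M -> Rabs (snd p) <= M ->
  forall q, K q -> dist2 q p < b ^ 2 -> b <= f q).
{ intros p; destruct (classic (Rabs (fst p) <= M /\ Rabs (snd p) <= M)) as [[h1 h2] | h].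
  - destruct (hf p h1 h2) as [b [hb h]]; exists (mkposreal b hb); auto.
  - exists (mkposreal 1 Rlt_0_1); tauto. }
assert (delta : {delta : R * R -> posreal | forall p, Rabs (fst p) <= M -> Rabs (snd p) <= M ->
  forall q, K q -> dist2 q p < delta p ^ 2 -> delta p <= f q}).
{ exists (fun p => proj1_sig (constructive_indefinite_description _ (H p))).
  intros p; destruct constructive_indefinite_description; simpl; assumption. }
destruct delta as [delta hdelta].
(* Radii are halved because the covering consists of squares while [dist2] measures discs. *)
destruct (compactness_value_2d (- M) M (- M) M
  (fun u v => mkposreal (delta (u, v) / 2) (is_pos_div_2 (delta (u, v))))) as [d hd].
exists d; split; [apply cond_pos |].
(* The compactness lemma concludes with a double negation, so the goal is first turned into
   [False]. *)
intros q hq; apply Rnot_lt_le; intros hlt.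
destruct (hK q hq) as [h1 h2].
apply Rabs_le_between in h1, h2.
apply (hd _ _ h1 h2); intros (u & v & hu & hv & hxu & hyv & hduv); simpl in *.
assert (hq' : delta (u, v) <= f q).
{ apply hdelta; simpl; try (now apply Rabs_le_between); [assumption |].
  now apply comp_dist2. }
assert (0 < delta (u, v)) by apply cond_pos. lra.
Qed.

Lemma locally_bounded_below_continuous (M : R) (f : R * R -> R) (K : R * R -> Prop) :
  (forall p, continuous f p) ->
  (forall p, Rabs (fst p) <= M -> Rabs (snd p) <= M -> ~ K p ->
     exists d, 0 < d /\ forall q, dist2 q p < d ^ 2 -> ~ K q) ->
  (forall p, K p -> 0 < f p) ->
  locally_bounded_below M K f.
Proof.
intros hc hK hf p h1 h2.
destruct (classic (K p)) as [hp | hp].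
- assert (h := hf p hp).
  destruct (continuous_dist2 f p (hc p) (f p / 2)) as [d [hd hd']]; [lra |].
  exists (Rmin d (f p / 2)).
  assert (hm := Rmin_r d (f p / 2)).
  split; [apply Rmin_case; lra |].
  intros q _ hq; apply dist2_Rmin in hq; [| lra | lra].
  assert (h3 := hd' q (proj1 hq)). apply Rabs_def2 in h3. lra.
- destruct (hK p h1 h2 hp) as [d [hd h]].
  exists d; split; [assumption |]; intros q hq hqp; now elim (h q hqp).
Qed.

(** An upper bound for [|f|] amounts to a positive lower bound for [1 / (1 + |f|)]. *)
Lemma continuous_square_bounded (M : R) (f : R * R -> R) :
  (forall p, continuous f p) ->
  exists B, 0 < B /\ forall p, Rabs (fst p) <= M -> Rabs (snd p) <= M -> Rabs (f p) <= B.
Proof.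
intros hc.
destruct (square_bounded_below M (fun p => Rabs (fst p) <= M /\ Rabs (snd p) <= M)
  (fun p => / (1 + Rabs (f p)))) as [b [hb h]].
- auto.
- apply locally_bounded_below_continuous.
  + intros p; apply (continuous_compR f (fun t => / (1 + Rabs t))); [apply hc |].
    apply (continuous_comp (fun t => 1 + Rabs t) Rinv).
    * apply (continuous_plus (fun _ => 1) Rabs); [apply continuous_const | apply continuous_Rabs].
    * apply continuous_Rinv; assert (hp := Rabs_pos (f p)); lra.
  + tauto.
  + intros p _; apply Rinv_0_lt_compat; assert (hp := Rabs_pos (f p)); lra.
- exists (/ b); split; [now apply Rinv_0_lt_compat |].
  intros p h1 h2.
  assert (hp := Rabs_pos (f p)). assert (hi := h p (conj h1 h2)).
  apply Rinv_le_contravar in hi; [| assumption].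
  rewrite Rinv_inv in hi; lra.
Qed.

(** * The one-dimensional profiles *)

Definition glue (c : R) (f g : R -> R) (x : R) : R := if Rle_dec x c then f x else g x.

Lemma glue_le (c : R) (f g : R -> R) (x : R) : x <= c -> glue c f g x = f x.
Proof. intros h; unfold glue; destruct (Rle_dec x c); [reflexivity | contradiction]. Qed.

Lemma glue_ge (c : R) (f g : R -> R) (x : R) : f c = g c -> c <= x -> glue c f g x = g x.
Proof.
intros e h; unfold glue; destruct (Rle_dec x c); [| reflexivity].
now replace x with c by lra.
Qed.

Lemma glue_derive (c : R) (f g f' g' : R -> R) :
  f c = g c -> f' c = g' c ->
  (forall x, is_derive f x (f' x)) -> (forall x, is_derive g x (g' x)) ->
  forall x, is_derive (glue c f g) x (glue c f' g' x).
Proof.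
intros e e' hf hg x; apply is_derive_Reals; intros eps heps.
destruct (proj1 (is_derive_Reals f x (f' x)) (hf x) eps heps) as [[d hd] h1].
destruct (proj1 (is_derive_Reals g x (g' x)) (hg x) eps heps) as [[d' hd'] h2].
simpl in h1, h2.
(* Increments shorter than [r] do not cross the junction; at the junction itself each side is
   handled by its own piece and [1] is arbitrary. *)
set (r := if Req_EM_T x c then 1 else Rabs (x - c)).
assert (hr : 0 < r).
{ unfold r; destruct (Req_EM_T x c); [lra | apply Rabs_pos_lt; lra]. }
assert (hm : 0 < Rmin r (Rmin d d')) by (repeat apply Rmin_case; assumption).
exists (mkposreal _ hm); simpl; intros h h0 hh.
assert (m1 := Rmin_l r (Rmin d d')). assert (m2 := Rmin_r r (Rmin d d')).
assert (m3 := Rmin_l d d'). assert (m4 := Rmin_r d d').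
destruct (Rtotal_order x c) as [hx | [hx | hx]].
- assert (x + h <= c).
  { assert (er : r = c - x)
      by (unfold r; destruct (Req_EM_T x c); [lra | rewrite Rabs_left; lra]).
    assert (a := Rle_abs h); lra. }
  rewrite !glue_le by lra. apply h1; [assumption | lra].
- rewrite (glue_le _ _ _ x), (glue_le _ _ _ x) by lra.
  destruct (Rle_or_lt h 0).
  + rewrite glue_le by lra. apply h1; [assumption | lra].
  + rewrite glue_ge by (assumption || lra). rewrite hx, e, e', <- hx.
    apply h2; [assumption | lra].
- assert (c <= x + h).
  { assert (er : r = x - c)
      by (unfold r; destruct (Req_EM_T x c); [lra | rewrite Rabs_right; lra]).
    assert (a := Rle_abs (- h)); rewrite Rabs_Ropp in a; lra. }
  rewrite !glue_ge by (assumption || lra). apply h2; [assumption | lra].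
Qed.

(** This exhibits a glued function as a composite of continuous ones, [Rmin] and [Rmax] being
    expressible through [Rabs]. *)
Lemma glue_Rmin_Rmax (c : R) (f g : R -> R) (x : R) : f c = g c ->
  f (Rmin x c) + g (Rmax x c) - f c = glue c f g x.
Proof. intros e; unfold glue, Rmin, Rmax; destruct (Rle_dec x c); rewrite ?e; ring. Qed.

Lemma Rmin_Rabs (x y : R) : (x + y - Rabs (x - y)) / 2 = Rmin x y.
Proof. unfold Rmin, Rabs; destruct Rle_dec, Rcase_abs; lra. Qed.

Lemma Rmax_Rabs (x y : R) : (x + y + Rabs (x - y)) / 2 = Rmax x y.
Proof. unfold Rmax, Rabs; destruct Rle_dec, Rcase_abs; lra. Qed.

Lemma glue_continuous (c : R) (f g : R -> R) : f c = g c ->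
  (forall x, continuous f x) -> (forall x, continuous g x) ->
  forall x, continuous (glue c f g) x.
Proof.
intros e hf hg x.
apply (continuous_ext (fun x => f (Rmin x c) + g (Rmax x c) - f c)).
- intros y; exact (glue_Rmin_Rmax c f g y e).
- apply (continuous_minus (fun x => f (Rmin x c) + g (Rmax x c))); [| apply continuous_const].
  apply (continuous_plus (fun x => f (Rmin x c)) (fun x => g (Rmax x c))).
  + apply (continuous_comp (fun x => Rmin x c) f); [| apply hf].
    apply (continuous_ext (fun x => (x + c - Rabs (x - c)) / 2)).
    { intros y; exact (Rmin_Rabs y c). }
    apply (continuous_mult (fun x => x + c - Rabs (x - c)) (fun _ => / 2) x); [| apply continuous_const].
    apply (continuous_minus (fun x => x + c) (fun x => Rabs (x - c)) x).
    * apply (continuous_plus (fun x : R => x) (fun _ => c) x); [apply continuous_id | apply continuous_const].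
    * apply (continuous_comp (fun x => x - c) Rabs); [| apply continuous_Rabs].
      apply (continuous_minus (fun x : R => x) (fun _ => c) x); [apply continuous_id | apply continuous_const].
  + apply (continuous_comp (fun x => Rmax x c) g); [| apply hg].
    apply (continuous_ext (fun x => (x + c + Rabs (x - c)) / 2)).
    { intros y; exact (Rmax_Rabs y c). }
    apply (continuous_mult (fun x => x + c + Rabs (x - c)) (fun _ => / 2) x); [| apply continuous_const].
    apply (continuous_plus (fun x => x + c) (fun x => Rabs (x - c)) x).
    * apply (continuous_plus (fun x : R => x) (fun _ => c) x); [apply continuous_id | apply continuous_const].
    * apply (continuous_comp (fun x => x - c) Rabs); [| apply continuous_Rabs].
      apply (continuous_minus (fun x : R => x) (fun _ => c) x); [apply continuous_id | apply continuous_const].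
Qed.

(** Even profile: [k * cos x] up to [PI / 2], then the solution of [f'' = - f / s ^ 2] with value 0
    and the same slope. Both pieces have second derivative 0 at the junction, so the result is C2 on
    the line. The factors [prof g s] and [prof 1 s] are the [x] and [y] summands of [u_og]. *)
Definition prof (k s : R) : R -> R :=
  glue (- (PI / 2)) (fun x => - (k * s) * sin ((- x - PI / 2) / s))
    (glue (PI / 2) (fun x => k * cos x) (fun x => - (k * s) * sin ((x - PI / 2) / s))).
Definition prof1 (k s : R) : R -> R :=
  glue (- (PI / 2)) (fun x => k * cos ((- x - PI / 2) / s))
    (glue (PI / 2) (fun x => - k * sin x) (fun x => - k * cos ((x - PI / 2) / s))).
Definition prof2 (k s : R) : R -> R :=
  glue (- (PI / 2)) (fun x => k / s * sin ((- x - PI / 2) / s))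
    (glue (PI / 2) (fun x => - k * cos x) (fun x => k / s * sin ((x - PI / 2) / s))).

(* The first point where the continuation of [prof k s] reaches its minimum [- (k * s)]. *)
Definition xhat (s : R) : R := PI / 2 + s * (PI / 2).

Section Profile.
Variables (k s : R).
Hypotheses (hk : 0 < k) (hs : 0 < s).

Let hpi : 0 < PI := PI_RGT_0.

Lemma glue_left_zero (x : R) : x = - (PI / 2) -> (- x - PI / 2) / s = 0.
Proof. intros ->; field; lra. Qed.

Lemma glue_right_zero (x : R) : x = PI / 2 -> (x - PI / 2) / s = 0.
Proof. intros ->; field; lra. Qed.

Ltac glue_point :=
  rewrite ?glue_le by lra;
  rewrite ?glue_left_zero, ?glue_right_zero by reflexivity;
  rewrite ?cos_neg, ?sin_neg, ?cos_PI2, ?sin_PI2, ?cos_0, ?sin_0; ring.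

Lemma prof_derive (x : R) : is_derive (prof k s) x (prof1 k s x).
Proof.
apply glue_derive; [glue_point | glue_point | |].
- intros y; auto_derive; [exact I | unfold Rdiv, Rminus; field; lra].
- apply glue_derive; [glue_point | glue_point | |].
  + intros y; auto_derive; [exact I | ring].
  + intros y; auto_derive; [exact I | unfold Rdiv, Rminus; field; lra].
Qed.

Lemma prof1_derive (x : R) : is_derive (prof1 k s) x (prof2 k s x).
Proof.
apply glue_derive; [glue_point | glue_point | |].
- intros y; auto_derive; [exact I | unfold Rdiv, Rminus; field; lra].
- apply glue_derive; [glue_point | glue_point | |].
  + intros y; auto_derive; [exact I | ring].
  + intros y; auto_derive; [exact I | unfold Rdiv, Rminus; field; lra].
Qed.

Lemma prof2_continuous (x : R) : continuous (prof2 k s) x.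
Proof.
apply glue_continuous; [glue_point | |].
- intros y; apply (ex_derive_continuous (fun x => k / s * sin ((- x - PI / 2) / s))).
  auto_derive; exact I.
- apply glue_continuous; [glue_point | |].
  + intros y; apply (ex_derive_continuous (fun x => - k * cos x)); auto_derive; exact I.
  + intros y; apply (ex_derive_continuous (fun x => k / s * sin ((x - PI / 2) / s))).
    auto_derive; exact I.
Qed.

Lemma prof_in (x : R) : Rabs x <= PI / 2 ->
  prof k s x = k * cos x /\ prof1 k s x = - k * sin x /\ prof2 k s x = - k * cos x.
Proof.
intros h; apply Rabs_le_between in h.
unfold prof, prof1, prof2.
rewrite !(glue_ge (- (PI / 2))) by (glue_point || lra).
rewrite !glue_le by lra. auto.
Qed.

(** In terms of [Rabs x] the odd function [prof1] is determined only up to sign, hence its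
    square. *)
Lemma prof_out (x : R) : PI / 2 <= Rabs x ->
  let t := (Rabs x - PI / 2) / s in
  prof k s x = - (k * s) * sin t /\ prof1 k s x ^ 2 = (k * cos t) ^ 2 /\
  prof2 k s x = k / s * sin t.
Proof.
intros h t; unfold t; clear t; unfold prof, prof1, prof2.
destruct (Rle_or_lt 0 x) as [hx | hx].
- rewrite Rabs_pos_eq in * by assumption.
  rewrite !(glue_ge (- (PI / 2))) by (glue_point || lra).
  rewrite !glue_ge by (glue_point || lra). split; [ring | split; ring].
- rewrite Rabs_left in * by assumption.
  rewrite !glue_le by lra. split; [ring | split; ring].
Qed.

Lemma out_angle (x : R) : PI / 2 <= Rabs x -> Rabs x <= xhat s ->
  0 <= (Rabs x - PI / 2) / s <= PI / 2.
Proof.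
unfold xhat; intros h1 h2; split.
- apply Rdiv_le_0_compat; lra.
- apply Rle_div_l; lra.
Qed.

Lemma prof_cases (x : R) : Rabs x <= xhat s ->
  (Rabs x <= PI / 2 /\ 0 <= prof k s x /\ prof2 k s x = - prof k s x) \/
  (PI / 2 <= Rabs x /\ prof k s x <= 0 /\ prof2 k s x = - prof k s x / s ^ 2).
Proof.
intros hx; destruct (Rle_or_lt (Rabs x) (PI / 2)) as [h | h].
- left; destruct (prof_in x h) as (e & _ & e2); rewrite e, e2.
  split; [assumption | split; [| ring]].
  apply Rabs_le_between in h; assert (0 <= cos x) by (apply cos_ge_0; lra). nra.
- right; apply Rlt_le in h; destruct (prof_out x h) as (e & _ & e2); rewrite e, e2.
  destruct (out_angle x h hx).
  assert (0 <= sin ((Rabs x - PI / 2) / s)) by (apply sin_ge_0; lra).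
  split; [assumption | split; [| field; lra]].
  assert (0 < k * s) by nra. nra.
Qed.

Lemma prof_pos (x : R) : Rabs x < PI / 2 -> 0 < prof k s x.
Proof.
intros h; destruct (prof_in x (Rlt_le _ _ h)) as (-> & _).
apply Rabs_def2 in h; assert (0 < cos x) by (apply cos_gt_0; lra). nra.
Qed.

Lemma prof_neg (x : R) : PI / 2 < Rabs x -> Rabs x <= xhat s -> prof k s x < 0.
Proof.
intros h hx; destruct (prof_out x (Rlt_le _ _ h)) as (-> & _).
destruct (out_angle x (Rlt_le _ _ h) hx).
assert (0 < (Rabs x - PI / 2) / s) by (apply Rdiv_lt_0_compat; lra).
assert (0 < sin ((Rabs x - PI / 2) / s)) by (apply sin_gt_0; lra).
assert (0 < k * s) by nra. nra.
Qed.

Lemma prof_decr (x y : R) : Rabs x < Rabs y -> Rabs y <= xhat s -> prof k s y < prof k s x.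
Proof.
intros h hy.
assert (hx := Rabs_pos x).
destruct (Rle_or_lt (Rabs y) (PI / 2)) as [h1 | h1].
- destruct (prof_in y h1) as (-> & _). destruct (prof_in x ltac:(lra)) as (-> & _).
  assert (ca : forall t, cos t = cos (Rabs t)).
  { intros t; unfold Rabs; destruct Rcase_abs; [now rewrite cos_neg | reflexivity]. }
  rewrite (ca x), (ca y).
  apply Rmult_lt_compat_l; [assumption |].
  apply cos_decreasing_1; lra.
- assert (hny := prof_neg y h1 hy).
  destruct (Rle_or_lt (Rabs x) (PI / 2)) as [h2 | h2].
  + destruct (prof_cases x ltac:(lra)) as [[_ [h3 _]] | [h3 [h4 h5]]]; [lra |].
    destruct (prof_in x h2) as (e & _). rewrite e.
    apply Rabs_le_between in h2; assert (0 <= cos x) by (apply cos_ge_0; lra). nra.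
  + destruct (prof_out y (Rlt_le _ _ h1)) as (-> & _).
    destruct (prof_out x (Rlt_le _ _ h2)) as (-> & _).
    destruct (out_angle y (Rlt_le _ _ h1) hy).
    destruct (out_angle x (Rlt_le _ _ h2) ltac:(lra)).
    assert (sin ((Rabs x - PI / 2) / s) < sin ((Rabs y - PI / 2) / s)).
    { apply sin_increasing_1; try lra.
      apply Rmult_lt_compat_r; [now apply Rinv_0_lt_compat | lra]. }
    assert (0 < k * s) by nra. nra.
Qed.

Lemma prof_xhat (x : R) : Rabs x = xhat s -> prof k s x = - (k * s) /\ prof2 k s x = k / s.
Proof.
intros h.
destruct (prof_out x) as (-> & _ & ->); [rewrite h; unfold xhat; nra |].
rewrite h; unfold xhat.
replace ((PI / 2 + s * (PI / 2) - PI / 2) / s) with (PI / 2) by (field; lra).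
rewrite sin_PI2; split; ring.
Qed.

Lemma prof_0 : prof k s 0 = k.
Proof. destruct (prof_in 0) as (-> & _); rewrite ?Rabs_R0, ?cos_0; lra. Qed.

Lemma prof_le (x : R) : Rabs x <= xhat s -> prof k s x <= k.
Proof.
intros h; destruct (Req_dec x 0) as [-> | hx]; [rewrite prof_0; lra |].
rewrite <- prof_0 at 2.
apply Rlt_le, prof_decr; [| assumption].
rewrite Rabs_R0; now apply Rabs_pos_lt.
Qed.

Lemma prof1_zero (x : R) : Rabs x <= xhat s -> prof1 k s x = 0 -> x = 0 \/ Rabs x = xhat s.
Proof.
intros h h0; destruct (Rle_or_lt (Rabs x) (PI / 2)) as [h1 | h1].
- left; destruct (prof_in x h1) as (_ & e & _); rewrite h0 in e.
  apply Rabs_le_between in h1.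
  destruct (Rtotal_order x 0) as [hx | [hx | hx]]; [| assumption |].
  + assert (sin x < 0) by (apply sin_lt_0_var; lra). nra.
  + assert (0 < sin x) by (apply sin_gt_0; lra). nra.
- right; apply Rlt_le in h1.
  destruct (prof_out x h1) as (_ & e & _); rewrite h0 in e.
  destruct (out_angle x h1 h) as [a b].
  destruct b as [b | b].
  + assert (0 < cos ((Rabs x - PI / 2) / s)) by (apply cos_gt_0; lra).
    assert (0 < k * cos ((Rabs x - PI / 2) / s)) by nra. nra.
  + assert (e1 : Rabs x - PI / 2 = s * ((Rabs x - PI / 2) / s)) by (field; lra).
    rewrite b in e1. unfold xhat; lra.
Qed.
End Profile.

(** * The domain *)

Lemma asin_range (v : R) : 0 <= v <= 1 -> 0 <= asin v <= PI / 2.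
Proof.
intros hv; assert (hp := PI_RGT_0); destruct (asin_bound v) as [h1 h2].
split; [| lra].
apply Rnot_lt_le; intros h.
assert (sin (asin v) < 0) by (apply sin_lt_0_var; lra).
rewrite sin_asin in H; lra.
Qed.

Lemma lt_asin_iff (t v : R) : 0 <= t <= PI / 2 -> 0 <= v <= 1 -> t < asin v <-> sin t < v.
Proof.
intros ht hv; assert (hp := PI_RGT_0); destruct (asin_range v hv) as [h1 h2].
rewrite <- (sin_asin v) at 2 by lra.
split; intros h.
- apply sin_increasing_1; lra.
- apply sin_increasing_0; lra.
Qed.

Lemma lt_acos_iff (y w : R) : Rabs y <= PI -> 0 <= w <= 1 -> Rabs y < acos w <-> w < cos y.
Proof.
intros hy hw; destruct (acos_bound w) as [h1 h2]; assert (h3 := Rabs_pos y).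
assert (cy : cos y = cos (Rabs y)).
{ unfold Rabs; destruct Rcase_abs; [now rewrite cos_neg | reflexivity]. }
rewrite cy. rewrite <- (cos_acos w) at 2 by lra.
split; intros h.
- apply cos_decreasing_1; lra.
- apply cos_decreasing_0; lra.
Qed.

Lemma acos_le_PI2 (w : R) : 0 <= w <= 1 -> acos w <= PI / 2.
Proof.
intros hw; destruct (acos_bound w) as [h1 h2].
apply Rnot_lt_le; intros h.
assert (cos (acos w) < 0) by (apply cos_lt_0; lra).
rewrite cos_acos in H; lra.
Qed.

Section Domain.
Variables (om g : R).
Let s := sqrt om.
Hypotheses (hom : 1 <= om) (hg1 : 1 / s <= g) (hg2 : g <= s).

Definition U (q : R * R) : R := prof g s (fst q) + prof 1 s (snd q).

Lemma s_ge_1 : 1 <= s.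
Proof. unfold s; rewrite <- sqrt_1; now apply sqrt_le_1_alt. Qed.

Lemma s_sq : s ^ 2 = om.
Proof. unfold s; rewrite pow2_sqrt; lra. Qed.

Lemma g_pos : 0 < g.
Proof.
assert (h := s_ge_1).
assert (0 < 1 / s) by (apply Rdiv_lt_0_compat; lra). lra.
Qed.

Lemma gs_ge_1 : 1 <= g * s.
Proof. assert (h := s_ge_1); apply Rle_div_l in hg1; lra. Qed.

Let hpi := PI_RGT_0.
Let hs1 := s_ge_1.
Let hg := g_pos.
Let hgs := gs_ge_1.

Lemma s_pos : 0 < s.
Proof. lra. Qed.

Let hs := s_pos.

Lemma xhat_ge : PI <= xhat s.
Proof. unfold xhat; nra. Qed.

(** The bound [g <= s] keeps this [asin] in its range; [1 / s <= g] does the same in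
    [Xmax_asin_arg]. *)
Lemma inner_asin_arg (x : R) : Rabs x <= PI / 2 -> 0 <= g / s * cos x <= 1.
Proof.
intros h; apply Rabs_le_between in h.
assert (hc : 0 <= cos x) by (apply cos_ge_0; lra).
assert (hc1 := COS_bound x).
assert (0 < g / s) by (apply Rdiv_lt_0_compat; lra).
assert (g / s <= 1) by (apply Rle_div_l; lra).
split; nra.
Qed.

Lemma Xmax_asin_arg : 0 <= 1 / (g * s) <= 1.
Proof.
split.
- apply Rlt_le, Rdiv_lt_0_compat; lra.
- apply Rle_div_l; lra.
Qed.

(** The graph of [phi_og] is the curve [U = 0] solved for [y]. The square must be kept in the
    description, since [U] is positive again at points farther out. *)
Lemma Omega_og_iff (q : R * R) :
  Omega_og om g q <-> Rabs (fst q) <= xhat s /\ Rabs (snd q) <= xhat s /\ 0 < U q.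
Proof.
destruct q as [x y]; unfold Omega_og, Xmax, phi_og, U; fold s; simpl fst; simpl snd.
assert (hX := xhat_ge).
assert (hmax := asin_range _ Xmax_asin_arg).
destruct (Rle_dec (Rabs x) (PI / 2)) as [hx | hx].
- assert (hv := inner_asin_arg x hx). assert (ha := asin_range _ hv).
  destruct (prof_in g s hs x hx) as (e & _). rewrite e; clear e.
  assert (hc : 0 <= g * cos x).
  { replace (g * cos x) with (s * (g / s * cos x)) by (field; lra). nra. }
  destruct (Rlt_or_le (Rabs y) (PI / 2)) as [hy | hy].
  + assert (hp := prof_pos 1 s Rlt_0_1 hs y hy).
    split; intros; [repeat split; lra | split; nra].
  + destruct (prof_out 1 s hs y hy) as (e & _); rewrite e; clear e.
    set (t := (Rabs y - PI / 2) / s).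
    assert (ey : Rabs y = PI / 2 + s * t) by (unfold t; field; lra).
    split.
    * intros [_ h].
      assert (ht : t < asin (g / s * cos x)) by nra.
      assert (ht0 : 0 <= t) by (unfold t; apply Rdiv_le_0_compat; lra).
      apply lt_asin_iff in ht; [| lra | assumption].
      replace (g * cos x) with (s * (g / s * cos x)) by (field; lra).
      split; [lra | split; [unfold xhat; nra | nra]].
    * intros (_ & hy' & h).
      assert (ht : 0 <= t <= PI / 2) by (apply out_angle; lra).
      split; [nra |].
      rewrite ey; apply Rplus_lt_compat_l, Rmult_lt_compat_l; [lra |].
      apply lt_asin_iff; [assumption | assumption |].
      replace (g * cos x) with (s * (g / s * cos x)) in h by (field; lra). nra.
- apply Rnot_le_lt in hx.
  destruct (prof_out g s hs x (Rlt_le _ _ hx)) as (e & _); rewrite e; clear e.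
  set (t := (Rabs x - PI / 2) / s).
  assert (ex : Rabs x = PI / 2 + s * t) by (unfold t; field; lra).
  assert (ht0 : 0 <= t) by (unfold t; apply Rdiv_le_0_compat; lra).
  assert (hgsi : g * s * (1 / (g * s)) = 1) by (field; lra).
  split.
  + intros [h1 h2].
    assert (ht : t <= asin (1 / (g * s))) by nra.
    assert (hsin : 0 <= sin t <= 1 / (g * s)).
    { split; [apply sin_ge_0; lra |].
      destruct (Rle_lt_or_eq_dec _ _ ht) as [h | ->].
      - apply Rlt_le, lt_asin_iff; [lra | apply Xmax_asin_arg | assumption].
      - rewrite sin_asin; [lra | assert (a := Xmax_asin_arg); lra]. }
    assert (hw : 0 <= g * s * sin t <= 1) by nra.
    assert (hy : Rabs y < PI / 2) by (assert (a := acos_le_PI2 _ hw); lra).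
    apply lt_acos_iff in h2; [| lra | assumption].
    destruct (prof_in 1 s hs y ltac:(lra)) as (-> & _).
    split; [unfold xhat; nra | split; [lra | lra]].
  + intros (hx' & hy' & h).
    assert (ht : 0 <= t <= PI / 2) by (apply out_angle; lra).
    assert (hsin : 0 <= sin t) by (apply sin_ge_0; lra).
    assert (hw0 : 0 <= g * s * sin t) by nra.
    (* The profile in [x] is nonpositive here, so the one in [y] has to be positive. *)
    assert (hy : Rabs y < PI / 2).
    { apply Rnot_le_lt; intros hy.
      destruct (prof_cases 1 s Rlt_0_1 hs y hy') as [(a & b & _) | (a & b & _)]; [| lra].
      destruct (prof_in 1 s hs y a) as (e & _).
      destruct (prof_out 1 s hs y hy) as (e' & _).
      replace (Rabs y - PI / 2) with 0 in e' by lra.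
      replace (0 / s) with 0 in e' by (field; lra). rewrite sin_0 in e'. lra. }
    destruct (prof_in 1 s hs y ltac:(lra)) as (e & _); rewrite e in h; clear e.
    assert (hc := COS_bound y).
    split.
    * rewrite ex; apply Rplus_le_compat_l, Rmult_le_compat_l; [lra |].
      apply Rlt_le, lt_asin_iff; [assumption | apply Xmax_asin_arg | nra].
    * apply lt_acos_iff; lra.
Qed.

(** For [|x| > PI / 2] the formula of [u_og] uses [cos y] whatever [y] is. The profile in [x] is
    negative there, so [0 <= U] forces [|y| <= PI / 2], where the two formulas agree. *)
Lemma u_og_eq (q : R * R) :
  Rabs (fst q) <= xhat s -> Rabs (snd q) <= xhat s -> 0 <= U q -> u_og om g q = U q.
Proof.
destruct q as [x y]; unfold u_og, U; fold s; simpl fst; simpl snd; intros hx hy h.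
destruct (Rle_dec (Rabs x) (PI / 2)) as [h1 | h1].
- destruct (prof_in g s hs x h1) as (-> & _).
  destruct (Rle_dec (Rabs y) (PI / 2)) as [h2 | h2].
  + destruct (prof_in 1 s hs y h2) as (-> & _); lra.
  + destruct (prof_out 1 s hs y ltac:(lra)) as (-> & _).
    rewrite cos_plus, cos_PI2, sin_PI2; ring.
- apply Rnot_le_lt in h1.
  assert (hn := prof_neg g s hg hs x h1 hx).
  destruct (prof_out g s hs x ltac:(lra)) as (e & _); rewrite e in *; clear e.
  destruct (prof_cases 1 s Rlt_0_1 hs y hy) as [(a & b & _) | (a & b & _)]; [| lra].
  destruct (prof_in 1 s hs y a) as (-> & _).
  rewrite cos_plus, cos_PI2, sin_PI2; ring.
Qed.

(** On the edges of the square [U] is at most [1 - g * s] or [g - s], both nonpositive. Openness of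
    the domain rests on this. *)
Lemma U_pos_interior (q : R * R) :
  Rabs (fst q) <= xhat s -> Rabs (snd q) <= xhat s -> 0 < U q ->
  Rabs (fst q) < xhat s /\ Rabs (snd q) < xhat s.
Proof.
unfold U; intros hx hy h.
assert (a := prof_le g s hg hs _ hx). assert (b := prof_le 1 s Rlt_0_1 hs _ hy).
split; apply Rnot_le_lt; intros h'.
- destruct (prof_xhat g s hs (fst q)) as (e & _); [lra |]. nra.
- destruct (prof_xhat 1 s hs (snd q)) as (e & _); [lra |]. nra.
Qed.

(** Both profiles decrease strictly in the absolute value, so a homothety maps the closed domain
    into the open one. A nonzero coordinate provides strictness; at the origin [U = g + 1]. *)
Lemma U_scale (q : R * R) (r : R) : 0 < r < 1 ->
  Rabs (fst q) <= xhat s -> Rabs (snd q) <= xhat s -> 0 <= U q ->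
  0 < U (r * fst q, r * snd q).
Proof.
unfold U; simpl fst; simpl snd; intros hr hx hy h.
assert (H : forall k, 0 < k -> forall x, Rabs x <= xhat s ->
  (x = 0 \/ prof k s x < prof k s (r * x))).
{ intros k hk x hx'; destruct (Req_dec x 0) as [-> | h0]; [now left | right].
  apply prof_decr; try assumption.
  rewrite Rabs_mult, (Rabs_pos_eq r) by lra.
  assert (a := Rabs_pos_lt x h0); nra. }
destruct (H g hg _ hx) as [e1 | h1], (H 1 Rlt_0_1 _ hy) as [e2 | h2].
- rewrite e1, e2, Rmult_0_r, !prof_0 by lra; lra.
- rewrite e1 in h |- *; rewrite Rmult_0_r; lra.
- rewrite e2 in h |- *; rewrite Rmult_0_r; lra.
- lra.
Qed.

Lemma U_continuous (q : R * R) : continuous U q.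
Proof.
assert (H : forall k, 0 < k -> forall x, continuous (prof k s) x).
{ intros k hk x; apply (ex_derive_continuous (prof k s)); eexists; now apply prof_derive. }
unfold U; apply continuous_plusR; (apply continuous_compR; [destruct q |]).
- apply continuous_fst.
- apply H; assumption.
- apply continuous_snd.
- apply H; lra.
Qed.
End Domain.

(** * The Pucci operator on sheared diagonal matrices *)

(* With the unit vectors [v = (1, 0)] and [v' = (- al, sg)], the matrix below is
   [(A v v^T + B v' v'^T) / sg ^ 2]. *)
Section ShearedPucci.
Variables (lam Lam al sg A B : R).
Hypotheses (h0 : 0 < lam) (hl : lam <= Lam) (hsg : 0 < sg) (hal : sg ^ 2 = 1 - al ^ 2).

Let k := al / sg.
(** The larger eigenvalue of [A v v^T + B v' v'^T], which has trace [A + B] and determinant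
    [(1 - al ^ 2) * (A * B)]. *)
Let e := (A + B) / 2 + sqrt (((A - B) / 2) ^ 2 + al ^ 2 * (A * B)).

Lemma pucci_plus_shear :
  pucci_plus lam Lam (A / sg ^ 2 + k ^ 2 * B) (- (k * B)) B =
  (lam * (A + B) + (Lam - lam) * Rmax 0 (Rmax (A + B) e)) / sg ^ 2.
Proof.
assert (hS : 0 < / sg ^ 2) by (apply Rinv_0_lt_compat; nra).
assert (et : A / sg ^ 2 + k ^ 2 * B + B = / sg ^ 2 * (A + B)).
{ replace (A / sg ^ 2 + k ^ 2 * B + B) with ((A + (al ^ 2 + sg ^ 2) * B) / sg ^ 2)
    by (unfold k; field; lra).
  rewrite hal; field; nra. }
assert (ee : top_eig (A / sg ^ 2 + k ^ 2 * B) (- (k * B)) B = / sg ^ 2 * e).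
{ unfold top_eig, e; rewrite et.
  replace (((A / sg ^ 2 + k ^ 2 * B - B) / 2) ^ 2 + (- (k * B)) ^ 2)
    with ((/ sg ^ 2) ^ 2 * (((A - B) / 2) ^ 2 + al ^ 2 * (A * B))).
  - rewrite sqrt_mult_alt by apply pow2_ge_0.
    rewrite sqrt_pow2 by lra. field; lra.
  - replace (al ^ 2) with (1 - sg ^ 2) by lra.
    replace ((- (k * B)) ^ 2) with (k ^ 2 * B ^ 2) by ring.
    replace (k ^ 2) with ((1 - sg ^ 2) / sg ^ 2); [field; lra |].
    unfold k; replace (1 - sg ^ 2) with (al ^ 2) by lra; field; lra. }
rewrite pucci_plusE, et, ee, RmaxRmult by lra.
rewrite <- (Rmult_0_r (/ sg ^ 2)) at 1.
rewrite RmaxRmult by lra. field; lra.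
Qed.

Variables (om f h : R).
Hypotheses (hom : Lam = lam * om) (hom0 : 0 < om).
Hypotheses (hA : (0 <= f /\ A = - f) \/ (f <= 0 /\ A = - f / om)).
Hypotheses (hB : (0 <= h /\ B = - h) \/ (h <= 0 /\ B = - h / om)).
Hypothesis hfh : 0 <= f + h.

Lemma pos_div_om (x : R) : x <= 0 -> 0 <= - x / om /\ Lam * (- x / om) = - lam * x.
Proof.
intros hx; split.
- apply Rdiv_le_0_compat; lra.
- rewrite hom; field; lra.
Qed.

(** Two negative profiles are excluded by [0 <= f + h], so [A] and [B] are never both positive. In
    each remaining case the one-dimensional Pucci values are [- lam * f] and [- lam * h]. *)
Lemma shear_cases :
  (A <= 0 /\ B <= 0 /\ A = - f /\ B = - h) \/
  (0 <= A /\ B <= 0 /\ Lam * A = - lam * f /\ B = - h) \/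
  (A <= 0 /\ 0 <= B /\ A = - f /\ Lam * B = - lam * h).
Proof.
destruct hA as [[a1 a2] | [a1 a2]], hB as [[b1 b2] | [b1 b2]].
- left; lra.
- destruct (pos_div_om h b1) as [c1 c2]; rewrite <- b2 in c1, c2. right; right; lra.
- destruct (pos_div_om f a1) as [c1 c2]; rewrite <- a2 in c1, c2. right; left; lra.
- assert (ef : f = 0) by lra. assert (eh : h = 0) by lra.
  assert (z : - 0 / om = 0) by (field; lra).
  rewrite ef, eh, z in *. left; lra.
Qed.

Lemma al_le_1 : 0 <= al ^ 2 <= 1.
Proof. assert (a := pow2_ge_0 al). assert (b := pow2_ge_0 sg). lra. Qed.

(** With a nonpositive determinant zero lies between the eigenvalues, so [e] realises the maximum in
    [pucci_plus_shear]. *)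
Lemma shear_e_ge : A * B <= 0 -> 0 <= e /\ A + B <= e.
Proof.
intros hAB; assert (ha := al_le_1).
assert (Rabs ((A + B) / 2) <= sqrt (((A - B) / 2) ^ 2 + al ^ 2 * (A * B))).
{ rewrite <- sqrt_Rsqr_abs; apply sqrt_le_1_alt; unfold Rsqr.
  assert (0 <= (1 - al ^ 2) * - (A * B)) by (apply Rmult_le_pos; lra). nra. }
assert (a := Rle_abs ((A + B) / 2)). assert (b := Rle_abs (- ((A + B) / 2))).
rewrite Rabs_Ropp in b. unfold e; lra.
Qed.

(** Without shear [e] is [Rmax A B]. With [Y = |A - B| / 2] and [z] the claimed loss, the root is
    [sqrt (Y ^ 2 - 2 * M * z)], which is at most [Y - z] because [z <= Y <= M]. *)
Lemma shear_e_le (M : R) : 0 < M -> Rabs A <= M -> Rabs B <= M -> A * B <= 0 ->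
  e <= Rmax A B - al ^ 2 / (2 * M) * - (A * B).
Proof.
intros hM hAM hBM hAB; assert (ha := al_le_1).
assert (hY : 0 <= Rabs ((A - B) / 2) <= M).
{ split; [apply Rabs_pos |]. unfold Rabs in *; repeat destruct Rcase_abs; lra. }
assert (em : Rmax A B = (A + B) / 2 + Rabs ((A - B) / 2)).
{ unfold Rmax, Rabs; destruct Rle_dec, Rcase_abs; lra. }
rewrite em; unfold e.
rewrite <- (pow2_abs ((A - B) / 2)).
assert (hP : - (A * B) <= Rabs ((A - B) / 2) ^ 2).
{ rewrite pow2_abs. assert (t := pow2_ge_0 ((A + B) / 2)). nra. }
set (Y := Rabs ((A - B) / 2)) in *.
set (z := al ^ 2 / (2 * M) * - (A * B)).
assert (ez : 2 * M * z = al ^ 2 * - (A * B)) by (unfold z; field; lra).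
set (P := - (A * B)) in *.
assert (hP0 : 0 <= P) by (unfold P; lra).
replace (al ^ 2 * (A * B)) with (- (al ^ 2 * P)) by (unfold P; ring).
rewrite <- ez.
assert (hz : 0 <= z).
{ apply Rmult_le_pos; [apply Rdiv_le_0_compat; lra | assumption]. }
assert (hzY : z <= Y).
{ apply Rnot_lt_le; intros hlt.
  assert (2 * M * z <= Y ^ 2) by (rewrite ez; nra).
  assert (M * z >= Y * z) by nra. assert (Y * z >= Y * Y) by nra.
  destruct (Req_dec Y 0) as [e0 | ne]; [rewrite e0 in *; nra | nra]. }
enough (sqrt (Y ^ 2 + - (2 * M * z)) <= Y - z) by lra.
rewrite <- (sqrt_pow2 (Y - z)) by lra.
apply sqrt_le_1_alt; nra.
Qed.

(** For [A, B <= 0] both eigenvalues are nonpositive and the left side is 0. For opposite signs it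
    would be 0 with [Rmax A B] in place of [e], so the loss in [shear_e_le] is the whole gain. This
    one estimate yields both the supersolution property and its strictness. *)
Lemma pucci_shear_defect (M : R) : 0 < M -> Rabs A <= M -> Rabs B <= M ->
  pucci_plus lam Lam (A / sg ^ 2 + k ^ 2 * B) (- (k * B)) B + lam / sg ^ 2 * (f + h) <=
  - ((Lam - lam) * al ^ 2 / (2 * M * sg ^ 2) * Rmax 0 (- (A * B))).
Proof.
intros hM hAM hBM; rewrite pucci_plus_shear.
assert (hS : 0 < sg ^ 2) by nra.
assert (ha := al_le_1).
assert (H : A * B <= 0 -> Rmax 0 (Rmax (A + B) e) <= Rmax A B - al ^ 2 / (2 * M) * - (A * B)).
{ intros hAB; destruct (shear_e_ge hAB).
  rewrite Rmax_right; [| apply Rmax_Rle; now right].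
  rewrite Rmax_right by assumption. now apply shear_e_le. }
enough (lam * (A + B) + (Lam - lam) * Rmax 0 (Rmax (A + B) e) + lam * (f + h) <=
  - ((Lam - lam) * (al ^ 2 / (2 * M)) * Rmax 0 (- (A * B)))) as H1.
{ replace (_ + lam / sg ^ 2 * (f + h)) with (/ sg ^ 2 *
    (lam * (A + B) + (Lam - lam) * Rmax 0 (Rmax (A + B) e) + lam * (f + h))) by (field; lra).
  replace (- ((Lam - lam) * al ^ 2 / (2 * M * sg ^ 2) * Rmax 0 (- (A * B)))) with
    (/ sg ^ 2 * - ((Lam - lam) * (al ^ 2 / (2 * M)) * Rmax 0 (- (A * B)))) by (field; lra).
  apply Rmult_le_compat_l; [| assumption].
  now apply Rlt_le, Rinv_0_lt_compat. }
destruct shear_cases as [(a1 & b1 & a2 & b2) | [(a1 & b1 & a2 & b2) | (a1 & b1 & a2 & b2)]].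
- rewrite (Rmax_left 0 (- (A * B))) by nra.
  assert (he : e <= 0).
  { unfold e.
    enough (sqrt (((A - B) / 2) ^ 2 + al ^ 2 * (A * B)) <= - ((A + B) / 2)) by lra.
    rewrite <- (sqrt_pow2 (- ((A + B) / 2))) by lra.
    apply sqrt_le_1_alt.
    assert (0 <= A * B) by nra.
    assert (0 <= (1 - al ^ 2) * (A * B)) by (apply Rmult_le_pos; lra). nra. }
  assert (ab : Rmax (A + B) e <= 0) by (apply Rmax_lub; lra).
  rewrite (Rmax_left 0 (Rmax (A + B) e)) by assumption. rewrite a2, b2; lra.
- assert (hAB : A * B <= 0) by nra.
  assert (b3 : lam * B = - lam * h) by (rewrite b2; ring).
  rewrite (Rmax_right 0 (- (A * B))) by lra.
  assert (H2 := H hAB). rewrite (Rmax_left A B) in H2 by lra.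
  assert (H3 := Rmult_le_compat_l (Lam - lam) _ _ ltac:(lra) H2). lra.
- assert (hAB : A * B <= 0) by nra.
  assert (a3 : lam * A = - lam * f) by (rewrite a2; ring).
  rewrite (Rmax_right 0 (- (A * B))) by lra.
  assert (H2 := H hAB). rewrite (Rmax_right A B) in H2 by lra.
  assert (H3 := Rmult_le_compat_l (Lam - lam) _ _ ltac:(lra) H2). lra.
Qed.

(** For [al = 0] the eigenvalue [e] is exactly [Rmax A B]; for [om = 1] the operator is [lam] times
    the trace. The comparison argument uses the inequality in this direction. *)
Lemma pucci_shear_exact : al = 0 \/ om = 1 ->
  0 <= pucci_plus lam Lam (A / sg ^ 2 + k ^ 2 * B) (- (k * B)) B + lam / sg ^ 2 * (f + h).
Proof.
intros hyp; rewrite pucci_plus_shear.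
assert (hS : 0 < sg ^ 2) by nra.
enough (0 <= lam * (A + B) + (Lam - lam) * Rmax 0 (Rmax (A + B) e) + lam * (f + h)) as H1.
{ replace (_ + lam / sg ^ 2 * (f + h)) with (/ sg ^ 2 *
    (lam * (A + B) + (Lam - lam) * Rmax 0 (Rmax (A + B) e) + lam * (f + h))) by (field; lra).
  apply Rmult_le_pos; [| assumption].
  now apply Rlt_le, Rinv_0_lt_compat. }
destruct hyp as [hyp | hyp].
- assert (he : e = (A + B) / 2 + Rabs ((A - B) / 2)).
  { unfold e; rewrite hyp, <- sqrt_Rsqr_abs; do 2 f_equal; unfold Rsqr; ring. }
  assert (m1 := Rmax_l 0 (Rmax (A + B) e)).
  assert (m2 := Rle_trans _ _ _ (Rmax_r (A + B) e) (Rmax_r 0 (Rmax (A + B) e))).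
  assert (c1 := Rle_abs ((A - B) / 2)). assert (c2 := Rle_abs (- ((A - B) / 2))).
  rewrite Rabs_Ropp in c2.
  set (m := Rmax 0 _) in *.
  destruct shear_cases as [(a1 & b1 & a2 & b2) | [(a1 & b1 & a2 & b2) | (a1 & b1 & a2 & b2)]].
  + nra.
  + assert (b3 : lam * B = - lam * h) by (rewrite b2; ring).
    assert (m3 := Rmult_le_compat_l (Lam - lam) A m ltac:(lra) ltac:(lra)). lra.
  + assert (a3 : lam * A = - lam * f) by (rewrite a2; ring).
    assert (m3 := Rmult_le_compat_l (Lam - lam) B m ltac:(lra) ltac:(lra)). lra.
- assert (eL : Lam = lam) by (rewrite hom, hyp; ring).
  destruct shear_cases as [(a1 & b1 & a2 & b2) | [(a1 & b1 & a2 & b2) | (a1 & b1 & a2 & b2)]];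
    nra.
Qed.
End ShearedPucci.

(** * The sheared domain *)

Lemma jet_ext (f fx fy fxx fxy fyy g gx gy gxx gxy gyy : R * R -> R) :
  jet f fx fy fxx fxy fyy ->
  (forall p, f p = g p) -> (forall p, fx p = gx p) -> (forall p, fy p = gy p) ->
  (forall p, fxx p = gxx p) -> (forall p, fxy p = gxy p) -> (forall p, fyy p = gyy p) ->
  jet g gx gy gxx gxy gyy.
Proof.
intros J e ex ey exx exy eyy.
apply functional_extensionality in e, ex, ey, exx, exy, eyy.
now rewrite <- e, <- ex, <- ey, <- exx, <- exy, <- eyy.
Qed.

Definition sg (a : R) : R := sqrt (1 - (a / PI) ^ 2).
Definition kap (a : R) : R := a / PI / sg a.

(* [(cX a r p, cY a r p)] is [Ca_inv a p / r], see [Ca_inv_coord]. *)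
Definition cX (a r : R) (p : R * R) : R := / (r * sg a) * fst p + 0 * snd p.
Definition cY (a r : R) (p : R * R) : R := - (kap a / r) * fst p + / r * snd p.

(** The candidate eigenfunction of the domain dilated by [r], continued to the plane; [r = 1]
    belongs to [u_oga]. *)
Definition V (om g a r : R) (p : R * R) : R :=
  prof g (sqrt om) (cX a r p) + prof 1 (sqrt om) (cY a r p).

Section Sheared.
Variables (lam Lam om g a : R).
Let s := sqrt om.
Hypotheses (h0 : 0 < lam) (hLam : Lam = lam * om) (hom : 1 <= om).
Hypotheses (hg1 : 1 / s <= g) (hg2 : g <= s) (ha : Rabs a < PI).

Let hs1 : 1 <= s := s_ge_1 om hom.
Let hs : 0 < s := s_pos om hom.
Let hg : 0 < g := g_pos om g hom hg1.

Lemma lam_le_Lam : lam <= Lam.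
Proof. rewrite hLam; nra. Qed.

Let hl := lam_le_Lam.

Lemma al_sq_lt_1 : (a / PI) ^ 2 < 1.
Proof.
assert (hp := PI_RGT_0).
assert (e : (a / PI * PI) ^ 2 = a ^ 2) by (f_equal; field; lra).
assert (a ^ 2 < PI ^ 2) by (rewrite <- (pow2_abs a); assert (b := Rabs_pos a); nra).
apply Rnot_le_lt; intros h. rewrite Rpow_mult_distr in e. nra.
Qed.

Lemma sg_pos : 0 < sg a.
Proof. apply sqrt_lt_R0; assert (h := al_sq_lt_1); lra. Qed.

Lemma sg_sq : sg a ^ 2 = 1 - (a / PI) ^ 2.
Proof. apply pow2_sqrt; assert (h := al_sq_lt_1); lra. Qed.

Let hsg := sg_pos.

Lemma eig_const : lam * PI ^ 2 / (PI ^ 2 - a ^ 2) = lam / sg a ^ 2.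
Proof.
assert (hp := PI_RGT_0).
rewrite sg_sq.
assert (h := al_sq_lt_1).
assert (e : (a / PI) ^ 2 * PI ^ 2 = a ^ 2) by (field; lra).
replace (PI ^ 2 - a ^ 2) with (PI ^ 2 * (1 - (a / PI) ^ 2)) by (rewrite <- e; ring).
set (d := 1 - (a / PI) ^ 2) in *.
field; unfold d; lra.
Qed.

Lemma Ca_inv_coord (p : R * R) : Ca_inv a p = (cX a 1 p, cY a 1 p).
Proof.
unfold Ca_inv, cX, cY, kap; fold (sg a); f_equal; field; assert (hp := PI_RGT_0); lra.
Qed.

Lemma cX_scale (r : R) (p : R * R) : r <> 0 -> cX a r p = cX a 1 p / r.
Proof. intros hr; unfold cX; field; lra. Qed.

Lemma cY_scale (r : R) (p : R * R) : r <> 0 -> cY a r p = cY a 1 p / r.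
Proof. intros hr; unfold cY; field; lra. Qed.

Lemma coord_Ca (r : R) (q : R * R) : r <> 0 ->
  cX a r (Ca a (r * fst q, r * snd q)) = fst q /\ cY a r (Ca a (r * fst q, r * snd q)) = snd q.
Proof.
intros hr; assert (hp := PI_RGT_0).
unfold cX, cY, kap, Ca; fold (sg a); simpl fst; simpl snd; split; field; lra.
Qed.

Lemma Ca_coord (r : R) (p : R * R) : r <> 0 -> Ca a (r * cX a r p, r * cY a r p) = p.
Proof.
intros hr; assert (hp := PI_RGT_0).
destruct p as [x y].
unfold cX, cY, kap, Ca; fold (sg a); simpl fst; simpl snd; f_equal; field; lra.
Qed.

Lemma U_V (p : R * R) : U om g (cX a 1 p, cY a 1 p) = V om g a 1 p.
Proof. reflexivity. Qed.

Lemma Omega_oga_iff (p : R * R) : Omega_oga om g a p <->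
  Rabs (cX a 1 p) <= xhat s /\ Rabs (cY a 1 p) <= xhat s /\ 0 < V om g a 1 p.
Proof.
unfold Omega_oga; rewrite <- U_V; split.
- intros [q [hq ->]].
  assert (hc := coord_Ca 1 q R1_neq_R0).
  rewrite !Rmult_1_l, <- surjective_pairing in hc.
  destruct hc as [-> ->].
  apply (Omega_og_iff om g hom hg1 hg2) in hq. destruct q; exact hq.
- intros h; exists (cX a 1 p, cY a 1 p); split.
  + now apply Omega_og_iff.
  + rewrite <- (Ca_coord 1 p) at 1 by lra. now rewrite !Rmult_1_l.
Qed.

Lemma u_oga_V (p : R * R) :
  Rabs (cX a 1 p) <= xhat s -> Rabs (cY a 1 p) <= xhat s -> 0 <= V om g a 1 p ->
  u_oga om g a p = V om g a 1 p.
Proof.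
intros hx hy h; unfold u_oga; rewrite Ca_inv_coord.
now apply u_og_eq.
Qed.

Lemma u_oga_V_Omega (p : R * R) : Omega_oga om g a p -> u_oga om g a p = V om g a 1 p.
Proof. intros h; apply Omega_oga_iff in h; apply u_oga_V; tauto || lra. Qed.

Lemma jet_V (r : R) : r <> 0 ->
  let A p := prof2 g s (cX a r p) / r ^ 2 in
  let B p := prof2 1 s (cY a r p) / r ^ 2 in
  jet (V om g a r)
    (fun p => prof1 g s (cX a r p) / (r * sg a) - kap a / r * prof1 1 s (cY a r p))
    (fun p => prof1 1 s (cY a r p) / r)
    (fun p => A p / sg a ^ 2 + kap a ^ 2 * B p) (fun p => - (kap a * B p)) B.
Proof.
intros hr A B.
eapply jet_ext.
- apply jet_plus; apply jet_comp; [apply jet_linear | | | | apply jet_linear | | | ].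
  + apply prof_derive, hs.
  + apply prof1_derive, hs.
  + apply prof2_continuous, hs.
  + apply prof_derive, hs.
  + apply prof1_derive, hs.
  + apply prof2_continuous, hs.
- reflexivity.
- intros p; unfold cX, cY; field; lra.
- intros p; unfold cX, cY; field; lra.
- intros p; unfold A, B; cbv beta; fold (cX a r p) (cY a r p); field; lra.
- intros p; unfold A, B; cbv beta; fold (cX a r p) (cY a r p); field; lra.
- intros p; unfold A, B; cbv beta; fold (cX a r p) (cY a r p); field; lra.
Qed.

Lemma V_continuous (r : R) (p : R * R) : r <> 0 -> continuous (V om g a r) p.
Proof. intros hr; apply (jet_cont _ _ _ _ _ _ (jet_V r hr)). Qed.

Lemma cX_continuous (r : R) (p : R * R) : continuous (cX a r) p.
Proof. apply (jet_cont _ _ _ _ _ _ (jet_linear _ _)). Qed.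

Lemma cY_continuous (r : R) (p : R * R) : continuous (cY a r) p.
Proof. apply (jet_cont _ _ _ _ _ _ (jet_linear _ _)). Qed.

(** Stated for every dilation factor: [r = 1] gives openness of the domain, [r < 1] the
    neighbourhood of a contact point in the comparison. *)
Lemma coord_domain_near (r : R) (p : R * R) : r <> 0 ->
  Rabs (cX a r p) <= xhat s -> Rabs (cY a r p) <= xhat s -> 0 < V om g a r p ->
  exists d, 0 < d /\ forall q, dist2 q p < d ^ 2 ->
    Rabs (cX a r q) <= xhat s /\ Rabs (cY a r q) <= xhat s /\ 0 < V om g a r q.
Proof.
intros hr hx hy hV.
destruct (U_pos_interior om g hom hg1 hg2 (cX a r p, cY a r p) hx hy hV) as [hx' hy'].
destruct (continuous_lt_near _ p _ (continuous_RabsR _ p (cX_continuous r p)) hx') as [d1 [hd1 H1]].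
destruct (continuous_lt_near _ p _ (continuous_RabsR _ p (cY_continuous r p)) hy') as [d2 [hd2 H2]].
destruct (continuous_lt_near _ p 0 (continuous_oppR _ p (V_continuous r p hr)))
  as [d3 [hd3 H3]]; [lra |].
assert (hd23 : 0 < Rmin d2 d3) by (apply Rmin_case; assumption).
exists (Rmin d1 (Rmin d2 d3)); split; [apply Rmin_case; assumption |].
intros q hq; apply dist2_Rmin in hq; [| assumption | assumption].
destruct hq as [q1 hq]; apply dist2_Rmin in hq; [| assumption | assumption].
destruct hq as [q2 q3].
assert (e := H3 q q3); split; [| split]; [| | lra]; apply Rlt_le; auto.
Qed.

Lemma open_Omega_oga : open2 (Omega_oga om g a).
Proof.
intros p hp; apply Omega_oga_iff in hp; destruct hp as (hx & hy & hV).
destruct (coord_domain_near 1 p R1_neq_R0 hx hy hV) as [d [hd h]].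
exists d; split; [assumption |]; intros q hq; apply Omega_oga_iff; auto.
Qed.

(** The defining inequalities pass to the closure weakly; [V > 0] would put [p] inside the open
    domain, away from its complement. *)
Lemma u_oga_boundary (p : R * R) : boundary (Omega_oga om g a) p -> u_oga om g a p = 0.
Proof.
intros [hcl hext].
assert (H : forall (f : R * R -> R) b, continuous f p ->
  (forall q, Omega_oga om g a q -> b <= f q) -> b <= f p).
{ intros f b hf hb; apply Rnot_lt_le; intros hlt.
  destruct (continuous_lt_near f p b hf hlt) as [d [hd h]].
  destruct (hcl d hd) as [q [hq hqp]].
  assert (h1 := hb q hq). assert (h2 := h q hqp). lra. }
assert (hx : Rabs (cX a 1 p) <= xhat s).
{ apply Ropp_le_cancel, (H (fun p => - Rabs (cX a 1 p))).
  - apply (continuous_oppR (fun p => Rabs (cX a 1 p))), continuous_RabsR, cX_continuous.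
  - intros q hq; apply Ropp_le_contravar; apply Omega_oga_iff in hq; tauto. }
assert (hy : Rabs (cY a 1 p) <= xhat s).
{ apply Ropp_le_cancel, (H (fun p => - Rabs (cY a 1 p))).
  - apply (continuous_oppR (fun p => Rabs (cY a 1 p))), continuous_RabsR, cY_continuous.
  - intros q hq; apply Ropp_le_contravar; apply Omega_oga_iff in hq; tauto. }
assert (hV : 0 <= V om g a 1 p).
{ apply H; [apply V_continuous, R1_neq_R0 |].
  intros q hq; apply Omega_oga_iff in hq; apply Rlt_le; tauto. }
rewrite u_oga_V by assumption.
destruct hV as [hV | hV]; [exfalso | now symmetry].
destruct (open_Omega_oga p) as [d [hd h]]; [now apply Omega_oga_iff |].
destruct (hext d hd) as [q [hq hqp]]; auto.
Qed.

Lemma u_oga_pos (p : R * R) : Omega_oga om g a p -> 0 < u_oga om g a p.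
Proof. intros h; rewrite u_oga_V_Omega by assumption; apply Omega_oga_iff in h; tauto. Qed.

Lemma prof2_bound (k x : R) : 0 < k -> k <= s -> Rabs x <= xhat s -> Rabs (prof2 k s x) <= s.
Proof.
intros hk hks hx; destruct (Rle_or_lt (Rabs x) (PI / 2)) as [h | h].
- destruct (prof_in k s hs x h) as (_ & _ & ->).
  assert (hc := COS_bound x). apply Rabs_le; nra.
- destruct (prof_out k s hs x ltac:(lra)) as (_ & _ & ->).
  assert (hc := SIN_bound ((Rabs x - PI / 2) / s)).
  assert (0 < k / s) by (apply Rdiv_lt_0_compat; lra).
  assert (k / s <= 1) by (apply Rle_div_l; lra).
  apply Rabs_le; nra.
Qed.

Lemma prof_ode (k x : R) : 0 < k -> Rabs x <= xhat s ->
  (0 <= prof k s x /\ prof2 k s x = - prof k s x) \/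
  (prof k s x <= 0 /\ prof2 k s x = - prof k s x / om).
Proof.
intros hk hx; rewrite <- (s_sq om hom); fold s.
destruct (prof_cases k s hk hs x hx) as [(_ & h) | (_ & h)]; auto.
Qed.

Lemma V_defect (p : R * R) :
  Rabs (cX a 1 p) <= xhat s -> Rabs (cY a 1 p) <= xhat s -> 0 <= V om g a 1 p ->
  let A := prof2 g s (cX a 1 p) in let B := prof2 1 s (cY a 1 p) in
  pucci_plus lam Lam (A / sg a ^ 2 + kap a ^ 2 * B) (- (kap a * B)) B
    + lam / sg a ^ 2 * V om g a 1 p <=
  - ((Lam - lam) * (a / PI) ^ 2 / (2 * s * sg a ^ 2) * Rmax 0 (- (A * B))).
Proof.
intros hx hy hV A B.
apply (pucci_shear_defect lam Lam (a / PI) (sg a) A B hl hsg sg_sq om).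
- exact hLam.
- lra.
- now apply prof_ode.
- apply prof_ode; [lra | assumption].
- exact hV.
- assumption.
- apply prof2_bound; assumption.
- apply prof2_bound; lra || assumption.
Qed.

Lemma V_exact (r : R) (p : R * R) : r <> 0 -> a = 0 \/ om = 1 ->
  Rabs (cX a r p) <= xhat s -> Rabs (cY a r p) <= xhat s -> 0 <= V om g a r p ->
  let A := prof2 g s (cX a r p) / r ^ 2 in let B := prof2 1 s (cY a r p) / r ^ 2 in
  0 <= pucci_plus lam Lam (A / sg a ^ 2 + kap a ^ 2 * B) (- (kap a * B)) B
    + lam / sg a ^ 2 / r ^ 2 * V om g a r p.
Proof.
intros hr hyp hx hy hV A B.
set (A' := prof2 g s (cX a r p)) in A. set (B' := prof2 1 s (cY a r p)) in B.
assert (hr2 : 0 < r ^ 2) by (apply pow2_gt_0; assumption).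
replace (A / sg a ^ 2 + kap a ^ 2 * B)
  with (/ r ^ 2 * (A' / sg a ^ 2 + kap a ^ 2 * B')) by (unfold A, B; field; lra).
replace (- (kap a * B)) with (/ r ^ 2 * (- (kap a * B'))) by (unfold B; field; lra).
replace B with (/ r ^ 2 * B') by (unfold B; field; lra).
rewrite pucci_plus_scal by (apply Rlt_le, Rinv_0_lt_compat; assumption).
replace (lam / sg a ^ 2 / r ^ 2 * V om g a r p) with (/ r ^ 2 * (lam / sg a ^ 2 * V om g a r p))
  by (field; lra).
rewrite <- Rmult_plus_distr_l.
apply Rmult_le_pos; [apply Rlt_le, Rinv_0_lt_compat; assumption |].
apply (pucci_shear_exact lam Lam (a / PI) (sg a) A' B' h0 hl hsg sg_sq om).
- exact hLam.
- lra.
- now apply prof_ode.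
- apply prof_ode; [lra | assumption].
- exact hV.
- destruct hyp as [e | hyp]; [left; rewrite e; field; apply PI_neq0 | now right].
Qed.

Lemma u_oga_visc_super :
  visc_super lam Lam (lam / sg a ^ 2) (Omega_oga om g a) (u_oga om g a).
Proof.
eapply smooth_visc_super; [exact h0 | exact hl | exact open_Omega_oga
  | exact (jet_V 1 R1_neq_R0) | exact u_oga_V_Omega |].
intros p hp; apply Omega_oga_iff in hp; destruct hp as (hx & hy & hV).
assert (h := V_defect p hx hy (Rlt_le _ _ hV)); cbv zeta in h.
cbv beta; rewrite pow1, !Rdiv_1_r.
eapply Rle_trans; [exact h |].
assert (hm := Rmax_l 0 (- (prof2 g s (cX a 1 p) * prof2 1 s (cY a 1 p)))).
assert (0 <= (Lam - lam) * (a / PI) ^ 2 / (2 * s * sg a ^ 2)).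
{ apply Rdiv_le_0_compat; [| nra].
  apply Rmult_le_pos; [lra | apply pow2_ge_0]. }
nra.
Qed.

Lemma eig_set_ge : eig_set lam Lam (Omega_oga om g a) (lam / sg a ^ 2).
Proof.
exists (u_oga om g a); split; [| split].
- apply (smooth_cont_on _ _ (V om g a 1)); [exact u_oga_V_Omega |].
  intros p; apply V_continuous, R1_neq_R0.
- exact u_oga_pos.
- exact u_oga_visc_super.
Qed.

(** * Comparison with the dilated domain *)

Lemma Ca_dist (r : R) (p q : R * R) : 0 < r < 1 ->
  dist2 (Ca a (r * fst q, r * snd q)) (Ca a (r * fst p, r * snd p)) <= 4 * dist2 q p.
Proof.
intros hr; unfold dist2, Ca; fold (sg a); simpl fst; simpl snd.
set (x := fst q - fst p). set (y := snd q - snd p).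
replace (_ + _) with (r ^ 2 * (sg a ^ 2 * x ^ 2 + (a / PI * x + y) ^ 2)) at 1
  by (unfold x, y; ring).
rewrite sg_sq.
assert (h := al_sq_lt_1).
set (al := a / PI) in *.
assert (h1 : 2 * (al * x) * y <= al ^ 2 * x ^ 2 + y ^ 2)
  by (assert (u := pow2_ge_0 (al * x - y)); lra).
assert (hx := pow2_ge_0 x). assert (hy := pow2_ge_0 y).
assert (h2 : al ^ 2 * x ^ 2 <= x ^ 2) by nra.
assert (h3 : 0 <= (1 - al ^ 2) * x ^ 2 + (al * x + y) ^ 2 <= 4 * (x ^ 2 + y ^ 2)).
{ assert (u := pow2_ge_0 (al * x + y)). split; [nra | lra]. }
assert (r ^ 2 <= 1) by nra. nra.
Qed.

(** The closed domain in the coordinates [q] before shear and dilation, where it lies in a fixed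
    square for all [a] and [r]. *)
Definition closed_domain (q : R * R) : Prop :=
  Rabs (fst q) <= xhat s /\ Rabs (snd q) <= xhat s /\ 0 <= U om g q.

Lemma Ca_closed_domain (r : R) (q : R * R) : 0 < r < 1 -> closed_domain q ->
  Omega_oga om g a (Ca a (r * fst q, r * snd q)).
Proof.
intros hr (hx & hy & hU).
assert (hr0 : r <> 0) by lra.
destruct (coord_Ca r q hr0) as [ex ey].
rewrite cX_scale in ex by assumption. rewrite cY_scale in ey by assumption.
set (p := Ca a _) in *.
assert (ex' : cX a 1 p = r * fst q) by (rewrite <- ex; field; assumption).
assert (ey' : cY a 1 p = r * snd q) by (rewrite <- ey; field; assumption).
apply Omega_oga_iff.
rewrite <- U_V, ex', ey', !Rabs_mult, (Rabs_pos_eq r) by lra.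
assert (a1 := Rabs_pos (fst q)). assert (a2 := Rabs_pos (snd q)).
split; [nra | split; [nra |]].
apply U_scale; assumption.
Qed.

Lemma closed_domain_closed (p : R * R) :
  Rabs (fst p) <= xhat s -> Rabs (snd p) <= xhat s -> ~ closed_domain p ->
  exists d, 0 < d /\ forall q, dist2 q p < d ^ 2 -> ~ closed_domain q.
Proof.
intros hx hy hp.
assert (hU : U om g p < 0) by (apply Rnot_le_lt; intros h; apply hp; repeat split; assumption).
destruct (continuous_lt_near _ p 0 (U_continuous om g hom hg1 p) hU) as [d [hd h]].
exists d; split; [assumption |]; intros q hq (_ & _ & hq'); assert (e := h q hq); lra.
Qed.

Lemma closed_domain_bounded_below (phi : R * R -> R) (r t : R) : 0 < r < 1 ->
  cont_on (Omega_oga om g a) phi ->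
  (forall q, closed_domain q -> 0 < phi (Ca a (r * fst q, r * snd q)) - t * U om g q) ->
  exists b, 0 < b /\
    forall q, closed_domain q -> b <= phi (Ca a (r * fst q, r * snd q)) - t * U om g q.
Proof.
intros hr hphi hpos.
apply (square_bounded_below (xhat s)); [intros p (? & ? & _); now split |].
intros p hx hy.
destruct (classic (closed_domain p)) as [hp | hp].
- assert (h := hpos p hp).
  set (Phi := fun q => phi (Ca a (r * fst q, r * snd q))).
  set (v := phi (Ca a (r * fst p, r * snd p)) - t * U om g p) in *.
  destruct (hphi _ (Ca_closed_domain r p hr hp) (v / 3)) as [d1 [hd1 H1]]; [lra |].
  destruct (continuous_dist2 (fun q => t * U om g q) p) with (eps := v / 3) as [d2 [hd2 H2]];
    [| lra |].
  { apply continuous_multR; [apply continuous_const | apply U_continuous; assumption]. }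
  (* The radius [d1] is halved since [Ca_dist] gives Lipschitz constant 2; two errors below [v / 3]
     leave at least [v / 3]. *)
  assert (hd12 : 0 < Rmin (d1 / 2) d2) by (apply Rmin_case; lra).
  exists (Rmin (Rmin (d1 / 2) d2) (v / 3)).
  assert (m := Rmin_r (Rmin (d1 / 2) d2) (v / 3)).
  split; [apply Rmin_case; lra |].
  intros q hq hqp; apply dist2_Rmin in hqp; [| assumption | lra].
  destruct hqp as [hqp _]; apply dist2_Rmin in hqp; [| lra | assumption].
  destruct hqp as [hq1 hq2].
  assert (hd := Ca_dist r p q hr).
  assert (e1 := H1 _ (Ca_closed_domain r q hr hq) ltac:(lra)).
  assert (e2 := H2 q hq2).
  apply Rabs_def2 in e1; apply Rabs_def2 in e2. unfold v in *; lra.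
- destruct (closed_domain_closed p hx hy hp) as [d [hd h]].
  exists d; split; [assumption |]; intros q hq hqp; now elim (h q hqp).
Qed.

Lemma U_le (q : R * R) : closed_domain q -> U om g q <= g + 1.
Proof.
intros (hx & hy & _); unfold U; fold s.
assert (b1 := prof_le g s hg hs _ hx). assert (b2 := prof_le 1 s Rlt_0_1 hs _ hy). lra.
Qed.

Lemma closed_domain_0 : closed_domain (0, 0) /\ U om g (0, 0) = g + 1.
Proof.
unfold closed_domain, U; fold s; simpl fst; simpl snd; rewrite !prof_0, Rabs_R0 by exact hs.
assert (h := xhat_ge om hom); assert (hp := PI_RGT_0); fold s in h. repeat split; lra.
Qed.

(** [tau] is the supremum of the [t] with [t * U <= Phi]. Without contact, compactness gives a gap
    [b > 0], and [U <= g + 1] lets [t] grow by [b / (g + 1)], contradicting the supremum. The same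
    increment from [t = 0] shows [tau > 0]. *)
Lemma first_contact (phi : R * R -> R) (r : R) : 0 < r < 1 ->
  cont_on (Omega_oga om g a) phi -> (forall p, Omega_oga om g a p -> 0 < phi p) ->
  exists tau q0, 0 < tau /\ closed_domain q0 /\
    phi (Ca a (r * fst q0, r * snd q0)) = tau * U om g q0 /\
    forall q, closed_domain q -> tau * U om g q <= phi (Ca a (r * fst q, r * snd q)).
Proof.
intros hr hc hpos.
set (Phi := fun q => phi (Ca a (r * fst q, r * snd q))).
set (E := fun t => forall q, closed_domain q -> t * U om g q <= Phi q).
destruct closed_domain_0 as [k0 e0].
assert (inc : forall t b, 0 < b -> (forall q, closed_domain q -> b <= Phi q - t * U om g q) ->
  E (t + b / (g + 1))).
{ intros t b hb h q hq.
  assert (h1 := h q hq). assert (h2 := U_le q hq).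
  assert (0 < b / (g + 1)) by (apply Rdiv_lt_0_compat; lra).
  assert (b / (g + 1) * (g + 1) = b) by (field; lra). nra. }
destruct (closed_domain_bounded_below phi r 0 hr hc) as [b [hb hbl]].
{ intros q hq; assert (h := hpos _ (Ca_closed_domain r q hr hq)); lra. }
assert (hE := inc 0 b hb hbl).
destruct (completeness E) as [tau [hub hlub]].
- exists (Phi (0, 0) / (g + 1)); intros t ht.
  assert (h := ht _ k0); rewrite e0 in h. apply Rle_div_r; lra.
- eexists; exact hE.
- assert (htau : 0 < tau).
  { assert (h := hub _ hE). assert (0 < b / (g + 1)) by (apply Rdiv_lt_0_compat; lra). lra. }
  assert (hEt : E tau).
  { intros q hq; destruct hq as (hx & hy & hU).
    destruct hU as [hU | hU].
    - apply Rle_div_r; [assumption |].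
      apply hlub; intros t ht; apply Rle_div_r; [assumption |].
      apply ht; repeat split; lra || assumption.
    - rewrite <- hU, Rmult_0_r.
      apply Rlt_le, hpos, Ca_closed_domain; [assumption |].
      repeat split; lra || assumption. }
  destruct (classic (exists q0, closed_domain q0 /\ Phi q0 = tau * U om g q0))
    as [[q0 [hq0 eq0]] | hno].
  + exists tau, q0; auto.
  + exfalso.
    destruct (closed_domain_bounded_below phi r tau hr hc) as [b' [hb' hbl']].
    { intros q hq; assert (h := hEt q hq).
      destruct (Req_dec (Phi q) (tau * U om g q)) as [e | ne]; [now elim hno; exists q |].
      unfold Phi in *; lra. }
    assert (h := hub _ (inc tau b' hb' hbl')).
    assert (0 < b' / (g + 1)) by (apply Rdiv_lt_0_compat; lra). lra.
Qed.

(* Comparison with the eigenfunction of the smaller homothetic domain: its positive multiple that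
   touches [phi] from below does so at an interior point. *)
Lemma eig_set_le (mu : R) : a = 0 \/ om = 1 -> eig_set lam Lam (Omega_oga om g a) mu ->
  mu <= lam / sg a ^ 2.
Proof.
intros hyp [phi (hc & hpos & hvisc)].
apply Rnot_lt_le; intros hmu.
set (c := lam / sg a ^ 2) in *.
assert (hcp : 0 < c) by (apply Rdiv_lt_0_compat; nra).
(* Chosen so that [r ^ 2 * mu] is the midpoint of [c] and [mu]: then [r < 1], while the constant
   [c / r ^ 2] of the dilated domain is still below [mu]. *)
set (r := sqrt ((c + mu) / (2 * mu))).
assert (hr2 : r ^ 2 = (c + mu) / (2 * mu)).
{ apply pow2_sqrt, Rdiv_le_0_compat; lra. }
assert (hr2' : r ^ 2 * mu = (c + mu) / 2) by (rewrite hr2; field; lra).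
assert (hr : 0 < r < 1).
{ assert (0 < r) by (apply sqrt_lt_R0, Rdiv_lt_0_compat; lra).
  split; [assumption |]; apply Rnot_le_lt; intros h1.
  assert (1 <= r ^ 2) by nra. nra. }
assert (hr0 : r <> 0) by lra.
destruct (first_contact phi r hr hc hpos) as (tau & q0 & htau & hq0 & eq0 & hle).
set (p0 := Ca a (r * fst q0, r * snd q0)) in *.
assert (hp0 := Ca_closed_domain r q0 hr hq0); fold p0 in hp0.
destruct (coord_Ca r q0 hr0) as [ex ey]; fold p0 in ex, ey.
assert (eV : V om g a r p0 = U om g q0) by (unfold V, U; now rewrite ex, ey).
assert (hV : 0 < V om g a r p0).
{ rewrite eV; assert (h := hpos p0 hp0); rewrite eq0 in h. nra. }
destruct hq0 as (hx & hy & hU).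
rewrite <- ex in hx; rewrite <- ey in hy.
assert (J := jet_scal _ _ _ _ _ _ (jet_V r hr0) tau).
assert (htouch : touches_below (Omega_oga om g a) phi (fun p => tau * V om g a r p) p0).
{ destruct (coord_domain_near r p0 hr0 hx hy hV) as [d [hd h]].
  exists d; split; [assumption |]; intros p _ hp.
  destruct (h p hp) as (h1 & h2 & h3).
  assert (h4 := hle (cX a r p, cY a r p)).
  simpl fst in h4; simpl snd in h4; rewrite Ca_coord in h4 by assumption.
  rewrite eq0, eV.
  assert (tau * U om g (cX a r p, cY a r p) <= phi p); [| unfold U, V in *; simpl in *; lra].
  apply h4; repeat split; [assumption | assumption | now apply Rlt_le]. }
assert (H := hvisc p0 _ hp0 (jet_C2 _ _ _ _ _ _ J) htouch).
rewrite (jet_pucciD2 _ _ _ _ _ _ J), pucci_plus_scal in H by lra.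
assert (H1 := V_exact r p0 hr0 hyp hx hy (Rlt_le _ _ hV)); cbv zeta in H1.
fold c in H1; rewrite eq0, <- eV in H.
assert (hcr : c / r ^ 2 < mu) by (apply Rlt_div_l; nra).
set (P := pucci_plus _ _ _ _ _) in *.
assert (0 < tau * ((mu - c / r ^ 2) * V om g a r p0))
  by (apply Rmult_lt_0_compat; [assumption |]; apply Rmult_lt_0_compat; lra).
nra.
Qed.
End Sheared.

(** * Strict supersolutions *)

Lemma exp_sub_1_le (x : R) : exp x - 1 <= x * exp x.
Proof.
assert (h := exp_ineq1_le (- x)). assert (hp := exp_pos x).
assert (e : exp x * exp (- x) = 1) by (rewrite <- exp_plus, Rplus_opp_r; apply exp_0).
nra.
Qed.

Lemma exp_le_compat (x y : R) : x <= y -> exp x <= exp y.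
Proof. intros [h | ->]; [now apply Rlt_le, exp_increasing | apply Rle_refl]. Qed.

Lemma Rmax0_Rabs (x : R) : (x + Rabs x) * / 2 = Rmax 0 x.
Proof. unfold Rmax, Rabs; destruct Rle_dec, Rcase_abs; lra. Qed.

Lemma continuous_Rmax0 (f : R * R -> R) (p : R * R) :
  continuous f p -> continuous (fun q => Rmax 0 (f q)) p.
Proof.
intros h.
apply (continuous_ext (fun q => (f q + Rabs (f q)) * / 2)).
- intros q; exact (Rmax0_Rabs (f q)).
- apply continuous_multR; [| apply continuous_const].
  apply continuous_plusR; [assumption | now apply continuous_RabsR].
Qed.

Section Perturbation.
Variables (lam Lam c : R) (Om : R * R -> Prop) (N : R * R -> R).
Variables (V Vx Vy Vxx Vxy Vyy w wx wy wxx wxy wyy : R * R -> R).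
Variables (m W C1 C2 Vm : R).
Hypotheses (h0 : 0 < lam) (hl : lam <= Lam) (hc : 0 <= c) (hOm : open2 Om).
Hypotheses (JV : jet V Vx Vy Vxx Vxy Vyy) (Jw : jet w wx wy wxx wxy wyy).
Hypothesis hV : forall p, Om p -> 0 < V p <= Vm.
Hypothesis hN0 : forall p, Om p -> 0 <= N p.
Hypothesis hN : forall p, Om p ->
  pucci_plus lam Lam (Vxx p) (Vxy p) (Vyy p) + c * V p <= - N p.
Hypotheses (hm0 : 0 < m) (hC1 : 0 < C1) (hC2 : 0 < C2) (hVm : 0 < Vm).
Hypothesis hm : forall p, Om p -> 2 * m <= N p + (wx p ^ 2 + wy p ^ 2).
Hypothesis hw : forall p, Om p -> 0 <= w p <= W /\ w p <= C1 * V p.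
Hypothesis hwC : forall p, Om p -> pucci_plus lam Lam (- wxx p) (- wxy p) (- wyy p) <= C2.

(** [al] makes the barrier term at most [- al] where the squared gradient of [w] is at least [m].
    The first bound on [eps] keeps the loss elsewhere below [m / 2], the second keeps the perturbed
    function above [V / 2]. *)
Let al := (C2 + 1) / (lam * m).
Let Zm := exp (al * W).
Let eps := Rmin (m / (2 * (al * Zm * C2))) (1 / (2 * (al * Zm * C1))).
Let Z p := exp (al * w p).

Lemma al_pos : 0 < al.
Proof. apply Rdiv_lt_0_compat; nra. Qed.

Lemma Zm_pos : 0 < Zm.
Proof. apply exp_pos. Qed.

Lemma eps_pos : 0 < eps.
Proof.
assert (a1 := al_pos). assert (a2 := Zm_pos). assert (0 < al * Zm) by nra.
apply Rmin_case; apply Rdiv_lt_0_compat; nra.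
Qed.

Lemma eps_le1 : eps * (al * Zm * C2) <= m / 2.
Proof.
assert (a1 := al_pos). assert (a2 := Zm_pos). assert (0 < al * Zm) by nra.
assert (0 < al * Zm * C2) by nra.
assert (h := Rmin_l (m / (2 * (al * Zm * C2))) (1 / (2 * (al * Zm * C1)))); fold eps in h.
apply Rle_trans with (m / (2 * (al * Zm * C2)) * (al * Zm * C2)); [nra |].
right; field; repeat split; lra.
Qed.

Lemma eps_le2 : eps * (al * Zm * C1) <= 1 / 2.
Proof.
assert (a1 := al_pos). assert (a2 := Zm_pos). assert (0 < al * Zm) by nra.
assert (0 < al * Zm * C1) by nra.
assert (h := Rmin_r (m / (2 * (al * Zm * C2))) (1 / (2 * (al * Zm * C1)))); fold eps in h.
apply Rle_trans with (1 / (2 * (al * Zm * C1)) * (al * Zm * C1)); [nra |].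
right; field; repeat split; lra.
Qed.

Lemma Z_bounds (p : R * R) : Om p -> 1 <= Z p <= Zm /\ Z p - 1 <= al * Zm * C1 * V p.
Proof.
intros hp; destruct (hw p hp) as [[w0 w1] w2]; assert (a1 := al_pos). assert (a2 := Zm_pos).
assert (hz : 1 <= Z p <= Zm).
{ unfold Z, Zm; split.
  - rewrite <- exp_0; apply exp_le_compat; nra.
  - apply exp_le_compat; nra. }
split; [assumption |].
assert (h := exp_sub_1_le (al * w p)); fold (Z p) in h.
assert (0 <= al * w p) by nra.
assert (al * w p <= al * (C1 * V p)) by nra.
apply Rle_trans with (al * w p * Zm); [nra |]. nra.
Qed.

(** The Hessian of [- exp (al * w)] splits into a negative rank-one part, of order [al ^ 2] and with
    Pucci value [lam] times its trace, and a part of order [al] bounded through [C2]. *)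
Lemma pucci_barrier (p : R * R) : Om p ->
  pucci_plus lam Lam
    (- (al * al * Z p * (wx p * wx p) + al * Z p * wxx p))
    (- (al * al * Z p * (wx p * wy p) + al * Z p * wxy p))
    (- (al * al * Z p * (wy p * wy p) + al * Z p * wyy p)) <=
  al * Z p * (C2 - al * lam * (wx p ^ 2 + wy p ^ 2)).
Proof.
intros hp; assert (ha := al_pos). destruct (Z_bounds p hp) as [[hz _] _].
assert (hz1 : 0 <= al * Z p) by nra.
assert (hz2 : 0 <= al * al * Z p) by nra.
assert (h := pucci_plus_subadd lam Lam
  (al * al * Z p * (- (wx p * wx p))) (al * al * Z p * (- (wx p * wy p)))
  (al * al * Z p * (- (wy p * wy p)))
  (al * Z p * - wxx p) (al * Z p * - wxy p) (al * Z p * - wyy p) hl).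
rewrite !pucci_plus_scal in h by assumption.
rewrite (pucci_plus_nsd lam Lam (- (wx p * wx p))) in h by nra.
assert (hC := Rmult_le_compat_l _ _ _ hz1 (hwC p hp)).
replace (- (al * al * Z p * (wx p * wx p) + al * Z p * wxx p))
  with (al * al * Z p * - (wx p * wx p) + al * Z p * - wxx p) by ring.
replace (- (al * al * Z p * (wx p * wy p) + al * Z p * wxy p))
  with (al * al * Z p * - (wx p * wy p) + al * Z p * - wxy p) by ring.
replace (- (al * al * Z p * (wy p * wy p) + al * Z p * wyy p))
  with (al * al * Z p * - (wy p * wy p) + al * Z p * - wyy p) by ring.
eapply Rle_trans; [exact h |]. lra.
Qed.

(* [V - eps * (exp (al * w) - 1)] is strict where [grad w] is not small by convexity of the
   exponential, and elsewhere because [V] already is. *)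
Lemma eig_set_perturb : exists mu, c < mu /\ eig_set lam Lam Om mu.
Proof.
assert (ha := al_pos). assert (hZm := Zm_pos). assert (he := eps_pos).
assert (he1 := eps_le1). assert (he2 := eps_le2).
(* The gain is [eps * al] where the gradient is large; elsewhere [N > m] and at least [m / 2] is
   left. Dividing by [Vm >= phi] turns it into a gain in the eigenvalue. *)
set (del := Rmin (eps * al) (m / 2)).
assert (hdel : 0 < del) by (apply Rmin_case; nra).
assert (d1 := Rmin_l (eps * al) (m / 2)). assert (d2 := Rmin_r (eps * al) (m / 2)).
fold del in d1, d2.
assert (hmu : 0 < del / Vm) by (apply Rdiv_lt_0_compat; assumption).
exists (c + del / Vm); split; [lra |].
assert (JZ : jet Z (fun p => al * exp (al * w p) * wx p) (fun p => al * exp (al * w p) * wy p)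
  (fun p => al * al * exp (al * w p) * (wx p * wx p) + al * exp (al * w p) * wxx p)
  (fun p => al * al * exp (al * w p) * (wx p * wy p) + al * exp (al * w p) * wxy p)
  (fun p => al * al * exp (al * w p) * (wy p * wy p) + al * exp (al * w p) * wyy p)).
{ apply (jet_comp _ _ _ _ _ _ Jw (fun t => exp (al * t)) (fun t => al * exp (al * t))
    (fun t => al * al * exp (al * t))).
  - intros t; auto_derive; [exact I | ring].
  - intros t; auto_derive; [exact I | ring].
  - intros t; apply (ex_derive_continuous (fun t => al * al * exp (al * t))).
    auto_derive; exact I. }
assert (Jphi := jet_plus _ _ _ _ _ _ _ _ _ _ _ _ JV
  (jet_scal _ _ _ _ _ _ (jet_plus _ _ _ _ _ _ _ _ _ _ _ _ JZ (jet_const (- 1))) (- eps))).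
set (phi := fun p => V p + - eps * (Z p + - 1)) in Jphi.
assert (hphi : forall p, Om p -> 0 < phi p <= V p).
{ intros p hp; destruct (Z_bounds p hp) as [[z1 z2] z3]; destruct (hV p hp) as [v1 v2].
  unfold phi; split; [| nra].
  assert (eps * (Z p - 1) <= eps * (al * Zm * C1) * V p) by nra.
  assert (eps * (al * Zm * C1) * V p <= 1 / 2 * V p) by (apply Rmult_le_compat_r; lra).
  lra. }
exists phi; split; [| split].
- apply (smooth_cont_on _ _ phi); [reflexivity |]; apply (jet_cont _ _ _ _ _ _ Jphi).
- intros p hp; now apply hphi.
- eapply smooth_visc_super; [exact h0 | exact hl | exact hOm | exact Jphi | reflexivity |].
  intros p hp; cbv beta.
  destruct (hphi p hp) as [f1 f2]; destruct (hV p hp) as [v1 v2].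
  destruct (Z_bounds p hp) as [[z1 z2] z3].
  assert (B := pucci_barrier p hp). assert (hNp := hN p hp). assert (hN0p := hN0 p hp).
  assert (hmp := hm p hp).
  change (exp (al * w p)) with (Z p).
  set (Zxx := al * al * Z p * (wx p * wx p) + al * Z p * wxx p) in *.
  set (Zxy := al * al * Z p * (wx p * wy p) + al * Z p * wxy p) in *.
  set (Zyy := al * al * Z p * (wy p * wy p) + al * Z p * wyy p) in *.
  assert (S := pucci_plus_subadd lam Lam (Vxx p) (Vxy p) (Vyy p)
    (eps * - Zxx) (eps * - Zxy) (eps * - Zyy) hl).
  rewrite pucci_plus_scal in S by lra.
  replace (Vxx p + - eps * (Zxx + 0)) with (Vxx p + eps * - Zxx) by ring.
  replace (Vxy p + - eps * (Zxy + 0)) with (Vxy p + eps * - Zxy) by ring.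
  replace (Vyy p + - eps * (Zyy + 0)) with (Vyy p + eps * - Zyy) by ring.
  assert (hmuphi : (c + del / Vm) * phi p <= c * phi p + del).
  { assert (del / Vm * Vm = del) by (field; lra).
    assert (del / Vm * phi p <= del / Vm * Vm) by (apply Rmult_le_compat_l; lra). lra. }
  assert (hcphi : c * phi p <= c * V p) by (apply Rmult_le_compat_l; lra).
  set (G := wx p ^ 2 + wy p ^ 2) in *.
  assert (hbar : - N p + eps * (al * Z p * (C2 - al * lam * G)) <= - del).
  { destruct (Rle_or_lt m G) as [hG | hG].
    - assert (hal : al * lam * G >= C2 + 1).
      { assert (e : al * lam * m = C2 + 1) by (unfold al; field; lra).
        rewrite <- e; apply Rle_ge, Rmult_le_compat_l; nra. }
      assert (al * Z p * (C2 - al * lam * G) <= - al).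
      { assert (al <= al * Z p) by nra. nra. }
      nra.
    - assert (hG0 : 0 <= G) by (unfold G; nra).
      assert (0 <= al * lam * G) by (apply Rmult_le_pos; nra).
      assert (al * Z p * (C2 - al * lam * G) <= al * Zm * C2).
      { assert (0 <= al * Z p) by nra.
        apply Rle_trans with (al * Z p * C2); [apply Rmult_le_compat_l; lra |].
        apply Rmult_le_compat_r; nra. }
      nra. }
  assert (B' := Rmult_le_compat_l eps _ _ (Rlt_le _ _ he) B).
  lra.
Qed.
End Perturbation.

(** * The weighted function and the strict inequality for [om > 1], [a <> 0] *)

Section Strict.
Variables (lam Lam om g a : R).
Let s := sqrt om.
Hypotheses (h0 : 0 < lam) (hLam : Lam = lam * om) (hom : 1 < om).
Hypotheses (hg1 : 1 / s <= g) (hg2 : g <= s) (ha : Rabs a < PI) (ha0 : a <> 0).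

Let hom' : 1 <= om := Rlt_le _ _ hom.
Let hs1 : 1 <= s := s_ge_1 om hom'.
Let hs : 0 < s := s_pos om hom'.
Let hg : 0 < g := g_pos om g hom' hg1.
Let hgs : 1 <= g * s := gs_ge_1 om g hom' hg1.

(* The critical points of [exp (2 y / g) * U om g (x, y)] lie where the second derivatives of the
   two profiles have opposite signs. *)
Lemma critical_defect (x y : R) :
  Rabs x <= xhat s -> Rabs y <= xhat s -> 0 <= prof g s x + prof 1 s y ->
  prof1 g s x = 0 -> prof1 1 s y + 2 / g * (prof g s x + prof 1 s y) = 0 ->
  prof2 g s x * prof2 1 s y < 0.
Proof.
intros hx hy hU h1 h2.
assert (hp := PI_RGT_0).
assert (hyle := prof_le 1 s Rlt_0_1 hs y hy).
destruct (prof1_zero g s hg hs x hx h1) as [-> | hx'].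
- rewrite (prof_0 g s hs) in *.
  destruct (prof_in g s hs 0) as (_ & _ & ->); [rewrite Rabs_R0; lra |].
  rewrite cos_0.
  destruct (Rle_or_lt (Rabs y) (PI / 2)) as [h | h].
  + exfalso.
    destruct (prof_in 1 s hs y h) as (e & e1 & _); rewrite e, e1 in h2.
    apply Rabs_le_between in h.
    assert (0 <= cos y) by (apply cos_ge_0; lra). assert (hs' := SIN_bound y).
    (* Origin of the weight [2 / g]: the constant 2 exceeds [sin y], so no critical point has
       [x = 0] and [|y| <= PI / 2]. *)
    replace (2 / g * (g + 1 * cos y)) with (2 + 2 / g * cos y) in h2 by (field; lra).
    assert (0 < 2 / g) by (apply Rdiv_lt_0_compat; lra). nra.
  + assert (hn := prof_neg 1 s Rlt_0_1 hs y h hy).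
    destruct (prof_out 1 s hs y (Rlt_le _ _ h)) as (e & _ & e2).
    rewrite e in hn; rewrite e2.
    set (t := sin _) in *.
    assert (0 < t) by nra.
    assert (0 < 1 / s) by (apply Rdiv_lt_0_compat; lra).
    assert (0 < 1 / s * t) by nra. nra.
(* This occurs only for [g * s = 1], at the tips of the closed domain on the [x] axis, where the
   gradient of [U] vanishes on the boundary. *)
- destruct (prof_xhat g s hs x hx') as [e e2]; rewrite e in hU; rewrite e2.
  assert (0 < g / s) by (apply Rdiv_lt_0_compat; lra).
  destruct (Rle_or_lt (Rabs y) (PI / 2)) as [h | h].
  + destruct (prof_in 1 s hs y h) as (ey & _ & ey2); rewrite ey in hU; rewrite ey2.
    assert (0 < cos y) by lra. nra.
  + assert (hn := prof_neg 1 s Rlt_0_1 hs y h hy). lra.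
Qed.

Let closed_image (p : R * R) : Prop :=
  Rabs (cX a 1 p) <= xhat s /\ Rabs (cY a 1 p) <= xhat s /\ 0 <= V om g a 1 p.

Lemma closed_image_bounded (p : R * R) : closed_image p ->
  Rabs (fst p) <= 2 * xhat s /\ Rabs (snd p) <= 2 * xhat s.
Proof.
intros (hx & hy & _).
assert (hsg := sg_pos a ha). assert (hsq := sg_sq a ha).
assert (hX := xhat_ge om hom'); fold s in hX. assert (hp := PI_RGT_0).
assert (e := Ca_coord a ha 1 p R1_neq_R0).
rewrite !Rmult_1_l in e; rewrite <- e.
unfold Ca; fold (sg a); simpl fst; simpl snd.
assert (hal := pow2_ge_0 (a / PI)).
assert (sg a <= 1) by nra.
assert (hal1 : Rabs (a / PI) <= 1).
{ rewrite <- (pow2_abs (a / PI)) in hsq. assert (b := Rabs_pos (a / PI)). nra. }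
assert (b := Rabs_pos (a / PI)). assert (b1 := Rabs_pos (cX a 1 p)).
split.
- rewrite Rabs_mult, (Rabs_pos_eq (sg a)) by lra. nra.
- eapply Rle_trans; [apply Rabs_triang |]. rewrite Rabs_mult. nra.
Qed.

Lemma closed_image_closed (p : R * R) : ~ closed_image p ->
  exists d, 0 < d /\ forall q, dist2 q p < d ^ 2 -> ~ closed_image q.
Proof.
intros hp.
assert (H : forall f : R * R -> R, continuous f p -> f p < 0 ->
  (forall q, closed_image q -> 0 <= f q) ->
  exists d, 0 < d /\ forall q, dist2 q p < d ^ 2 -> ~ closed_image q).
{ intros f hf hfp hfc; destruct (continuous_lt_near f p 0 hf hfp) as [d [hd h]].
  exists d; split; [assumption |]; intros q hq hq'.
  assert (e := h q hq). assert (e' := hfc q hq'). lra. }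
destruct (Rle_or_lt (Rabs (cX a 1 p)) (xhat s)) as [hx | hx].
2:{ apply (H (fun p => xhat s + - Rabs (cX a 1 p))).
    - apply continuous_plusR; [apply continuous_const |].
      apply (continuous_oppR (fun p => Rabs (cX a 1 p))), continuous_RabsR, cX_continuous.
    - lra.
    - intros q (h & _); lra. }
destruct (Rle_or_lt (Rabs (cY a 1 p)) (xhat s)) as [hy | hy].
2:{ apply (H (fun p => xhat s + - Rabs (cY a 1 p))).
    - apply continuous_plusR; [apply continuous_const |].
      apply (continuous_oppR (fun p => Rabs (cY a 1 p))), continuous_RabsR, cY_continuous.
    - lra.
    - intros q (_ & h & _); lra. }
apply (H (V om g a 1)).
- apply V_continuous; try assumption; exact R1_neq_R0.
- apply Rnot_le_lt; intros h; apply hp; repeat split; assumption.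
- intros q (_ & _ & h); assumption.
Qed.

(** By [critical_defect], the gain [N] and the gradient of [w] have no common zero on the compact
    closed image; compactness turns this into the constant [m] and supplies the bounds for
    [eig_set_perturb]. *)
Lemma eig_set_gt : exists mu, lam / sg a ^ 2 < mu /\ eig_set lam Lam (Omega_oga om g a) mu.
Proof.
assert (hl : lam < Lam) by (rewrite hLam; nra).
assert (hsg := sg_pos a ha). assert (hX := xhat_ge om hom'); fold s in hX.
assert (hp := PI_RGT_0).
assert (JV := jet_V om g a hom' ha 1 R1_neq_R0); cbv zeta in JV.
(* The weight [exp (2 / g * cY a 1 p)], with [cY] unfolded to a linear form. *)
assert (JE := jet_comp _ _ _ _ _ _ (jet_linear (- (kap a / 1)) (/ 1))
  (fun t => exp (2 / g * t)) (fun t => 2 / g * exp (2 / g * t))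
  (fun t => 2 / g * (2 / g) * exp (2 / g * t))
  ltac:(intros t; auto_derive; [exact I | ring])
  ltac:(intros t; auto_derive; [exact I | ring])
  ltac:(intros t; apply (ex_derive_continuous (fun t => 2 / g * (2 / g) * exp (2 / g * t)));
        auto_derive; exact I)).
assert (Jw := jet_mult _ _ _ _ _ _ _ _ _ _ _ _ JV JE).
fold s in JV, Jw.
match type of Jw with jet ?f ?fx ?fy ?fxx ?fxy ?fyy =>
  set (w := f) in *; set (wx := fx) in *; set (wy := fy) in *;
  set (wxx := fxx) in *; set (wxy := fxy) in *; set (wyy := fyy) in * end.
set (E := fun p : R * R => exp (2 / g * (- (kap a / 1) * fst p + / 1 * snd p))) in *.
set (AB := fun p => prof2 g s (cX a 1 p) * prof2 1 s (cY a 1 p)).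
set (k := (Lam - lam) * (a / PI) ^ 2 / (2 * s * sg a ^ 2)).
assert (hk : 0 < k).
{ assert (a / PI <> 0) by (unfold Rdiv; apply Rmult_integral_contrapositive; split;
    [assumption | apply Rinv_neq_0_compat; lra]).
  assert (0 < (a / PI) ^ 2) by (now apply pow2_gt_0).
  apply Rdiv_lt_0_compat; [nra |]. assert (0 < sg a ^ 2) by nra. nra. }
set (N := fun p => k * Rmax 0 (- AB p)).
assert (hN0 : forall p, 0 <= N p).
{ intros p; assert (h := Rmax_l 0 (- AB p)); unfold N; nra. }
assert (cN : forall p, continuous N p).
{ intros p; apply continuous_multR; [apply continuous_const |].
  apply (continuous_Rmax0 (fun q => - AB q)), (continuous_oppR AB), continuous_multR;
    apply continuous_compR; first [apply cX_continuous | apply cY_continuous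
      | apply prof2_continuous, hs]. }
assert (hO : forall p, Omega_oga om g a p -> closed_image p /\ 0 < V om g a 1 p).
{ intros p hp'; apply Omega_oga_iff in hp'; try assumption.
  destruct hp' as (hx & hy & hV); split; [repeat split; try assumption; now apply Rlt_le |
    assumption]. }
destruct (square_bounded_below (2 * xhat s) closed_image
  (fun p => N p + (wx p * wx p + wy p * wy p))) as [m [hm hmb]].
{ exact closed_image_bounded. }
{ apply locally_bounded_below_continuous.
  - intros p; apply continuous_plusR; [apply cN |].
    apply continuous_plusR; apply continuous_multR;
      first [apply (jet_cont_x _ _ _ _ _ _ Jw) | apply (jet_cont_y _ _ _ _ _ _ Jw)].
  - intros p _ _; apply closed_image_closed.
  - intros p (hx & hy & hV).
    assert (hE : 0 < E p) by apply exp_pos.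
    assert (ewy : wy p = E p * (prof1 1 s (cY a 1 p) + 2 / g * V om g a 1 p)).
    { unfold wy, E; field; lra. }
    (* In this triangular form a vanishing gradient in [p] is a vanishing gradient in the unsheared
       coordinates. *)
    assert (ewx : wx p = E p * (prof1 g s (cX a 1 p) / sg a) - kap a * wy p).
    { rewrite ewy; unfold wx, E; field; lra. }
    apply Rnot_le_lt; intros hle.
    assert (n0 := hN0 p).
    assert (q1 := Rle_0_sqr (wx p)). assert (q2 := Rle_0_sqr (wy p)). unfold Rsqr in q1, q2.
    assert (z1 : wx p = 0) by (apply Rsqr_0_uniq; unfold Rsqr; lra).
    assert (z2 : wy p = 0) by (apply Rsqr_0_uniq; unfold Rsqr; lra).
    assert (z3 : N p = 0) by lra.
    rewrite z2 in ewx; rewrite z1 in ewx; rewrite z2 in ewy.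
    assert (y1 : prof1 1 s (cY a 1 p) + 2 / g * V om g a 1 p = 0).
    { symmetry in ewy; apply Rmult_integral in ewy; destruct ewy; [lra | assumption]. }
    assert (y2 : prof1 g s (cX a 1 p) = 0).
    { assert (e : E p * (prof1 g s (cX a 1 p) / sg a) = 0) by lra.
      apply Rmult_integral in e; destruct e as [e | e]; [lra |].
      replace (prof1 g s (cX a 1 p)) with (prof1 g s (cX a 1 p) / sg a * sg a) by (field; lra).
      rewrite e; ring. }
    assert (d := critical_defect _ _ hx hy hV y2 y1). fold (AB p) in d.
    unfold N in z3; rewrite Rmax_right in z3 by lra. nra. }
destruct (continuous_square_bounded (2 * xhat s) w (jet_cont _ _ _ _ _ _ Jw)) as [W [hW Wb]].
destruct (continuous_square_bounded (2 * xhat s) E (jet_cont _ _ _ _ _ _ JE)) as [C1 [hC1 C1b]].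
destruct (continuous_square_bounded (2 * xhat s) _ (jet_cont_xx _ _ _ _ _ _ Jw)) as [B1 [hB1 B1b]].
destruct (continuous_square_bounded (2 * xhat s) _ (jet_cont_xy _ _ _ _ _ _ Jw)) as [B2 [hB2 B2b]].
destruct (continuous_square_bounded (2 * xhat s) _ (jet_cont_yy _ _ _ _ _ _ Jw)) as [B3 [hB3 B3b]].
refine (eig_set_perturb lam Lam (lam / sg a ^ 2) (Omega_oga om g a) N _ _ _ _ _ _
  w wx wy wxx wxy wyy (m / 2) W C1 (2 * Lam * (B1 + B2 + B3)) (g + 1)
  h0 (Rlt_le _ _ hl) _ _ JV Jw _ _ _ _ hC1 _ _ _ _ _); try lra.
- apply Rdiv_le_0_compat; [lra | nra].
- apply open_Omega_oga; assumption.
- intros p hp'; destruct (hO p hp') as [(hx & hy & _) hV]; split; [assumption |].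
  assert (b1 := prof_le g s hg hs _ hx). assert (b2 := prof_le 1 s Rlt_0_1 hs _ hy).
  unfold V; fold s; lra.
- auto.
- intros p hp'; destruct (hO p hp') as [(hx & hy & hV) _].
  cbv beta; rewrite pow1, !Rdiv_1_r.
  apply (V_defect lam Lam om g a); assumption || lra.
- apply Rmult_lt_0_compat; lra.
- intros p hp'; assert (h := hmb p (proj1 (hO p hp'))); cbv beta in h.
  replace (wx p ^ 2 + wy p ^ 2) with (wx p * wx p + wy p * wy p) by ring. lra.
- intros p hp'; destruct (hO p hp') as [hcl hV].
  destruct (closed_image_bounded p hcl) as [i1 i2].
  assert (hE : 0 < E p) by apply exp_pos.
  assert (u1 := Wb p i1 i2). assert (u2 := C1b p i1 i2).
  apply Rabs_le_between in u1; apply Rabs_le_between in u2.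
  assert (ew : w p = V om g a 1 p * E p) by reflexivity.
  split; [split; [rewrite ew; nra | lra] |]. rewrite ew; nra.
- intros p hp'; destruct (hO p hp') as [hcl hV].
  destruct (closed_image_bounded p hcl) as [i1 i2].
  eapply Rle_trans; [apply pucci_plus_le_abs; lra |].
  rewrite !Rabs_Ropp.
  assert (u1 := B1b p i1 i2). assert (u2 := B2b p i1 i2). assert (u3 := B3b p i1 i2).
  apply Rmult_le_compat_l; [lra |]. fold wxx wxy wyy in u1, u2, u3. lra.
Qed.
End Strict.

Theorem theorem2p3 (lam Lam g a : R) :
  0 < lam -> lam <= Lam ->
  let om := Lam / lam in
  1 / sqrt om <= g -> g <= sqrt om -> Rabs a < PI ->
  let c := lam * PI ^ 2 / (PI ^ 2 - a ^ 2) in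
  visc_super lam Lam c (Omega_oga om g a) (u_oga om g a) /\
  (forall p, Omega_oga om g a p -> 0 < u_oga om g a p) /\
  (forall p, boundary (Omega_oga om g a) p -> u_oga om g a p = 0) /\
  Rbar_le (Finite c) (principal_eig lam Lam (Omega_oga om g a)) /\
  (principal_eig lam Lam (Omega_oga om g a) = Finite c <-> (om = 1 \/ a = 0)).
Proof.
intros h0 hl om hg1 hg2 ha c.
assert (hLam : Lam = lam * om) by (unfold om; field; lra).
assert (hom : 1 <= om) by (unfold om; apply Rle_div_r; lra).
assert (ec : c = lam / sg a ^ 2) by now apply eig_const.
rewrite ec.
destruct (Lub_Rbar_correct (eig_set lam Lam (Omega_oga om g a))) as [hub hlub].
fold (principal_eig lam Lam (Omega_oga om g a)) in hub, hlub.
assert (hge := hub _ (eig_set_ge lam Lam om g a h0 hLam hom hg1 hg2 ha)).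
split; [now apply (u_oga_visc_super lam Lam om g a) |].
split; [now apply u_oga_pos |].
split; [now apply u_oga_boundary |].
split; [exact hge |].
split.
- intros e; destruct (classic (om = 1 \/ a = 0)) as [h | h]; [assumption | exfalso].
  apply not_or_and in h; destruct h as [h1 h2].
  destruct (Rle_lt_or_eq_dec _ _ hom) as [h3 | h3]; [| now elim h1].
  destruct (eig_set_gt lam Lam om g a h0 hLam h3 hg1 hg2 ha h2) as [mu [hmu hm]].
  assert (hb := hub mu hm); rewrite e in hb.
  change (mu <= lam / sg a ^ 2) in hb; lra.
- intros h; apply Rbar_le_antisym; [| exact hge].
  apply hlub; intros mu hmu.
  apply (eig_set_le lam Lam om g a); try assumption; tauto.
Qed.
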